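(* The Hassett subset $\mathcal{H}=\{d\in\mathbb{N} : d>6,\ d\equiv 0,2 \pmod 6\}$ satisfies $r_{prim}(\mathcal{H})=4$.
   Context: An integral quadratic form is a function $q\colon M\to\mathbb{Z}$ on a finite rank free $\mathbb{Z}$-module $M$ such that $q(nv)=n^2q(v)$ for all $n\in\mathbb{Z}$, $v\in M$, and $Q(u,v)=q(u+v)-q(u)-q(v)$ is bilinear and non-degenerate. It is positive if $q(v)>0$ for all $v\neq 0$. Its rank $\operatorname{rk}(q)$ is the rank of $M$ (the number of variables). For a positive integral quadratic form, $\operatorname{im}(q)\subset\mathbb{N}=\{1,2,3,\dots\}$ denotes the set of values of $q$ on nonzero vectors. A vector $v\in M$ is primitive if $v\ne0$ and $M/\mathbb{Z}v$ is torsion-free. For $S\subset\mathbb{N}$, the primitive supporting rank $r_{prim}(S)$ is the minimal rank of a positive integral quadratic form $q$ such that $\operatorname{im}(q)=S$ and every $n\in S$ equals $q(v)$ for some primitive vector $v$. *)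

(* Defs.v *)
From mathcomp Require Import all_boot all_order all_algebra.

Set Implicit Arguments.
Unset Strict Implicit.
Unset Printing Implicit Defensive.

Import Order.TTheory GRing.Theory Num.Theory.
Local Open Scope ring_scope.

(* [vectType int] is the interface of int-modules equipped with a linear
   isomorphism to some 'rV[int]_n, i.e. of free Z-modules of finite rank;
   [dim M] is that rank n. *)

Definition polar (M : vectType int) (q : M -> int) (u v : M) : int :=
  q (u + v) - q u - q v.

Definition bilinear_form (M : vectType int) (B : M -> M -> int) : Prop :=
  (forall u, scalar (B u)) /\ (forall v, scalar (B^~ v)).

(* Non-degenerate, as opposed to unimodular: the radicals are zero, but the
   map to the dual module need not be onto. *)
Definition nondegenerate (M : vectType int) (B : M -> M -> int) : Prop :=
  (forall u, (forall v, B u v = 0) -> u = 0) /\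
  (forall v, (forall u, B u v = 0) -> v = 0).

Definition integral_quadratic_form (M : vectType int) (q : M -> int) : Prop :=
  [/\ forall (n : int) (v : M), q (n *: v) = n ^+ 2 * q v,
      bilinear_form (polar q)
    & nondegenerate (polar q)].

Definition positive_form (M : vectType int) (q : M -> int) : Prop :=
  forall v, v <> 0 -> 0 < q v.

Definition im (M : vectType int) (q : M -> int) (n : nat) : Prop :=
  exists2 v : M, v <> 0 & q v = n%:Z.

Definition in_line (M : vectType int) (v w : M) : Prop :=
  exists k : int, w = k *: v.

(* The second clause says that M / Zv is torsion-free, with the classes of the
   quotient replaced by their representatives. *)
Definition primitive_vector (M : vectType int) (v : M) : Prop :=
  v <> 0 /\
  (forall (n : int) (w : M), n <> 0 -> in_line v (n *: w) -> in_line v w).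

Definition prim_supported_in_rank (S : nat -> Prop) (r : nat) : Prop :=
  exists (M : vectType int) (q : M -> int),
    [/\ dim M = r,
        integral_quadratic_form q,
        positive_form q,
        forall n : nat, im q n <-> S n
      & forall n : nat, S n -> exists2 v : M, primitive_vector v & q v = n%:Z].

(* [is_r_prim S r] reads r_prim(S) = r; it is a relation because the set of
   ranks over which the minimum is taken is empty for some S. *)
Definition is_r_prim (S : nat -> Prop) (r : nat) : Prop :=
  prim_supported_in_rank S r /\
  (forall r' : nat, prim_supported_in_rank S r' -> (r <= r')%N).

Definition hassett (d : nat) : Prop :=
  (6 < d)%N /\ (d = 0 %[mod 6] \/ d = 2 %[mod 6]).

(* Main.v *)
(* Write q = 2 f; the image of f must be the set of e >= 4 with e = 0 or 1 mod 3.

   Four variables suffice: the form f = nineteen_form satisfies 16 f = 19 l^2 + X^2 + Y^2 + Z^2 on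
   a lattice cut out by congruences modulo 8, 4, 4 on X, Y, Z and by X = Y = Z mod 3.  To
   represent e, take l = 1 or 3 according to e mod 3; then 16 e - 19 l^2 is 1 mod 4 and divisible
   by 3, so it is a sum of three squares, not all divisible by 3, and after permuting and changing
   signs these squares satisfy all the congruences.  The three-square theorem for n = 1 mod 4 is
   deduced as usual from a modulus m with m = -1 mod n (up to squares) and -n a square mod m.
   Instead of taking m prime by Dirichlet's theorem, one counts by the hyperbola method the values
   of sum_(d | m) chi(d) in an arithmetic progression, chi being the Kronecker symbol of -n.

   Three variables do not suffice: vectors with q = 8, 12 and then 14 or 18 span one of 236
   ternary forms, each anisotropic at some prime p, and then some e of the set is such that
   q - e t^2 is p-adically anisotropic too.  A vector with q = e would give, in rank at most 3, a
   nontrivial zero of that form. *)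
From Stdlib Require Import ZArith.
From Stdlib Require Lia List Bool.
Require Import Defs.

(** * Anisotropy of diagonal quaternary forms *)

Module TernaryObstruction.
Import Lia List Bool ListNotations.
Local Open Scope Z_scope.

(* Short-circuiting versions of [forallb] and [existsb], which [vm_compute] evaluates strictly. *)
Fixpoint every {A : Type} (P : A -> bool) (l : list A) : bool :=
  match l with [] => true | x :: l => if P x then every P l else false end.

Fixpoint some {A : Type} (P : A -> bool) (l : list A) : bool :=
  match l with [] => false | x :: l => if P x then true else some P l end.

Lemma everyP A (P : A -> bool) l : every P l = true <-> forall x, In x l -> P x = true.
Proof.
  rewrite <- forallb_forall. induction l as [|x l IH]; cbn; [tauto|].
  destruct (P x); cbn; [exact IH|tauto].
Qed.

Lemma someP A (P : A -> bool) l : some P l = true <-> exists x, In x l /\ P x = true.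
Proof.
  rewrite <- existsb_exists. induction l as [|x l IH]; cbn; [tauto|].
  destruct (P x); cbn; [tauto|exact IH].
Qed.

Definition diag4 (a b c d x y z t : Z) : Z := a * x ^ 2 + b * y ^ 2 + c * z ^ 2 + d * t ^ 2.

Definition anisotropic (a b c d : Z) : Prop :=
  forall x y z t, diag4 a b c d x y z t = 0 -> x = 0 /\ y = 0 /\ z = 0 /\ t = 0.

(** Infinite descent: a zero whose coordinates are all multiples of [p] can be divided by [p], which
    shrinks every nonzero coordinate. *)
Lemma anisotropic_descent p a b c d : 1 < p ->
  (forall x y z t, diag4 a b c d x y z t = 0 -> (p | x) /\ (p | y) /\ (p | z) /\ (p | t)) ->
  anisotropic a b c d.
Proof.
  intros p1 H.
  assert (main : forall n x y z t, Z.abs x + Z.abs y + Z.abs z + Z.abs t <= Z.of_nat n ->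
    diag4 a b c d x y z t = 0 -> x = 0 /\ y = 0 /\ z = 0 /\ t = 0).
  { induction n as [|n IH]; intros x y z t Hn E; [lia|].
    destruct (H x y z t E) as [[x' ->] [[y' ->] [[z' ->] [t' ->]]]].
    assert (E' : diag4 a b c d x' y' z' t' = 0).
    { unfold diag4 in *. apply (Z.mul_reg_l _ _ (p ^ 2)); [nia|]. rewrite Z.mul_0_r. etransitivity; [|exact E]. ring. }
    assert (K : forall u, u = 0 \/ Z.abs u < Z.abs (u * p)) by (intros u; rewrite Z.abs_mul; nia).
    destruct (K x') as [->|?], (K y') as [->|?], (K z') as [->|?], (K t') as [->|?];
      try (repeat split; reflexivity);
      (assert (R := fun h => IH _ _ _ _ h E'); lia). }
  intros x y z t. apply (main (Z.to_nat (Z.abs x + Z.abs y + Z.abs z + Z.abs t))). lia.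
Qed.

(** Anisotropy depends on the coefficients only up to squares; with enough fuel a nonzero [c] is
    left with [p]-adic valuation 0 or 1. *)
Fixpoint strip (fuel : nat) (p c : Z) : Z :=
  match fuel with
  | O => c
  | S f => if c mod (p * p) =? 0 then strip f p (c / (p * p)) else c
  end.

Lemma strip_spec p c fuel : 1 < p -> exists k, k <> 0 /\ c = k ^ 2 * strip fuel p c.
Proof.
  intros p1; revert c; induction fuel as [|f IH]; intros c; cbn [strip].
  - exists 1. lia.
  - destruct (Z.eqb_spec (c mod (p * p)) 0) as [E|E].
    + destruct (IH (c / (p * p))) as [k [k0 Hk]].
      exists (p * k). split; [nia|].
      assert (C := Z.div_mod c (p * p) ltac:(nia)). rewrite E, Z.add_0_r in C.
      etransitivity; [exact C|]. rewrite Hk at 1. ring.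
    + exists 1. lia.
Qed.

Lemma anisotropic_scale a b c d a' b' c' d' i j k l :
  i <> 0 -> j <> 0 -> k <> 0 -> l <> 0 ->
  a = i ^ 2 * a' -> b = j ^ 2 * b' -> c = k ^ 2 * c' -> d = l ^ 2 * d' ->
  anisotropic a' b' c' d' -> anisotropic a b c d.
Proof.
  intros i0 j0 k0 l0 -> -> -> -> H x y z t E.
  destruct (H (i * x) (j * y) (k * z) (l * t)) as [? [? [? ?]]].
  - etransitivity; [|exact E]. unfold diag4. ring.
  - assert (C : forall m u, m <> 0 -> m * u = 0 -> u = 0).
    { intros m u m0 M. apply Z.mul_eq_0 in M. lia. }
    repeat split; [apply (C i)|apply (C j)|apply (C k)|apply (C l)]; assumption.
Qed.

Definition no_sqrt (p m : Z) : bool :=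
  every (fun w => negb ((Z.of_nat w ^ 2 + m) mod p =? 0)) (seq 0 (Z.to_nat p)).

(** A computable substitute for the primality of [p]. *)
Definition invertible_residues (p : Z) : bool :=
  every (fun y => some (fun s => (Z.of_nat s * Z.of_nat y) mod p =? 1) (seq 0 (Z.to_nat p)))
    (seq 1 (Z.to_nat p - 1)).

Lemma no_sqrtP p m w : 1 < p -> no_sqrt p m = true -> ~ (p | w ^ 2 + m).
Proof.
  intros p1 H D. unfold no_sqrt in H. rewrite everyP in H.
  assert (B := Z.mod_pos_bound w p ltac:(lia)).
  specialize (H (Z.to_nat (w mod p))). rewrite in_seq, Z2Nat.id in H by lia.
  assert (I : (0 <= Z.to_nat (w mod p) < 0 + Z.to_nat p)%nat) by lia.
  specialize (H I). apply negb_true_iff in H. apply Z.eqb_neq in H. apply H.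
  apply Z.mod_divide; [lia|]. destruct D as [k Hk].
  exists (k - (w / p) * (w + w mod p)).
  assert (W : w - w mod p = p * (w / p)) by (assert (W := Z.div_mod w p ltac:(lia)); lia).
  transitivity ((w ^ 2 + m) - (w - w mod p) * (w + w mod p)); [ring|].
  rewrite W, Hk. ring.
Qed.

Lemma invertibleP p y : 1 < p -> invertible_residues p = true -> ~ (p | y) -> exists s k, s * y = 1 + k * p.
Proof.
  intros p1 H D. unfold invertible_residues in H. rewrite everyP in H.
  assert (B := Z.mod_pos_bound y p ltac:(lia)).
  assert (y0 : y mod p <> 0) by (intros E; apply D; apply Z.mod_divide; [lia|exact E]).
  specialize (H (Z.to_nat (y mod p))). rewrite in_seq in H.
  assert (I : (1 <= Z.to_nat (y mod p) < 1 + (Z.to_nat p - 1))%nat) by lia.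
  specialize (H I). apply someP in H. destruct H as [s [_ Hs]].
  apply Z.eqb_eq in Hs. rewrite Z2Nat.id in Hs by lia.
  exists (Z.of_nat s), ((Z.of_nat s * (y mod p)) / p + Z.of_nat s * (y / p)).
  assert (W := Z.div_mod y p ltac:(lia)).
  assert (V := Z.div_mod (Z.of_nat s * (y mod p)) p ltac:(lia)). rewrite Hs in V.
  etransitivity; [exact (f_equal (Z.mul (Z.of_nat s)) W)|].
  generalize dependent (Z.of_nat s * (y mod p) / p). intros q V.
  rewrite Z.mul_add_distr_l, V. ring.
Qed.

(** If [y] is a unit modulo [p], then [- u * v] is the square of [u * x / y], which [no_sqrt]
    excludes. If [p] divides [y] but not [x], it divides [u], and then [- u * v] is the square of
    0. *)
Lemma binary_anisotropic p u v x y : 1 < p -> invertible_residues p = true ->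
  no_sqrt p (u * v) = true -> (p | u * x ^ 2 + v * y ^ 2) -> (p | x) /\ (p | y).
Proof.
  intros p1 I N D.
  assert (uv : ~ (p | u * v)) by (intros E; apply (no_sqrtP p (u * v) 0 p1 N); exact E).
  destruct (Znumtheory.Zdivide_dec p y) as [py|py].
  - split; [|exact py]. destruct (Znumtheory.Zdivide_dec p x) as [px|px]; [exact px|exfalso].
    destruct (invertibleP p x p1 I px) as [s [k Hs]]. apply uv.
    destruct D as [e De], py as [y' ->].
    exists (v * (s ^ 2 * e - s ^ 2 * v * y' ^ 2 * p - u * k * (2 + k * p))).
    assert (X : s ^ 2 * x ^ 2 = (1 + k * p) ^ 2) by (rewrite <- Hs; ring). 
    assert (Y : s ^ 2 * (u * x ^ 2 + v * (y' * p) ^ 2) = s ^ 2 * (e * p)) by (rewrite De; ring).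
    assert (U : u * (1 + k * p) ^ 2 = s ^ 2 * (e * p) - s ^ 2 * v * (y' * p) ^ 2) by (rewrite <- X, <- Y; ring).
    transitivity (v * (u * (1 + k * p) ^ 2) - u * v * (2 * (k * p) + (k * p) ^ 2)); [ring|].
    rewrite U. ring.
  - exfalso. destruct (invertibleP p y p1 I py) as [s [k Hs]].
    apply (no_sqrtP p (u * v) (u * x * s) p1 N). destruct D as [e De].
    exists (s ^ 2 * u * e - u * v * k * (2 + k * p)).
    assert (X : s ^ 2 * y ^ 2 = (1 + k * p) ^ 2) by (rewrite <- Hs; ring). 
    transitivity (s ^ 2 * u * (u * x ^ 2 + v * y ^ 2) - u * v * (s ^ 2 * y ^ 2 - 1)); [ring|].
    rewrite De, X. ring.
Qed.

(** As in Springer's theorem, there are two residue forms: modulo [p] only the terms in [x], [y]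
    survive and force [p] to divide both; after division by [p] the same applies to [z], [t]. *)
Lemma anisotropic_primal p a b c d : 1 < p -> invertible_residues p = true ->
  no_sqrt p (a * b) = true -> no_sqrt p (c * d) = true -> anisotropic a b (p * c) (p * d).
Proof.
  intros p1 I ab cd. apply (anisotropic_descent p); [exact p1|]. intros x y z t E.
  unfold diag4 in E.
  destruct (binary_anisotropic p a b x y p1 I ab) as [[x' ->] [y' ->]].
  { exists (- (c * z ^ 2 + d * t ^ 2)).
    transitivity (- (p * c * z ^ 2 + p * d * t ^ 2)); [lia|ring]. }
  destruct (binary_anisotropic p c d z t p1 I cd) as [Hz Ht].
  { exists (- (a * x' ^ 2 + b * y' ^ 2)). apply (Z.mul_reg_l _ _ p); [lia|].
    transitivity (- (a * (x' * p) ^ 2 + b * (y' * p) ^ 2)); [|ring].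
    transitivity (p * c * z ^ 2 + p * d * t ^ 2); [ring|lia]. }
  repeat split; [exists x'|exists y'| |]; auto.
Qed.

Definition diag4_primal (p a b c d : Z) : bool :=
  if (c mod p =? 0) && (d mod p =? 0)
  then if no_sqrt p (a * b) then no_sqrt p ((c / p) * (d / p)) else false else false.

Definition all_residues (P : Z -> bool) : bool := every P [0; 1; 2; 3; 4; 5; 6; 7].

Definition diag4_dyadic (a b c d : Z) : bool :=
  all_residues (fun x => all_residues (fun y => all_residues (fun z => all_residues (fun t =>
    if diag4 a b c d x y z t mod 16 =? 0 then Z.even x && Z.even y && Z.even z && Z.even t else true)))).

Lemma diag4_primalP p a b c d : 1 < p -> invertible_residues p = true ->
  diag4_primal p a b c d = true -> anisotropic a b c d.
Proof.
  intros p1 I H. unfold diag4_primal in H.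
  destruct (Z.eqb_spec (c mod p) 0) as [Hc|]; [|discriminate].
  destruct (Z.eqb_spec (d mod p) 0) as [Hd|]; [|discriminate]. cbn [andb] in H.
  destruct (no_sqrt p (a * b)) eqn:ab; [|discriminate]. rename H into cd.
  rewrite (Z.div_mod c p), (Z.div_mod d p), Hc, Hd, !Z.add_0_r by lia.
  now apply anisotropic_primal.
Qed.

Lemma all_residuesP P x : all_residues P = true -> P (x mod 8) = true.
Proof.
  intros H. unfold all_residues in H. rewrite everyP in H. apply H. cbn [In].
  assert (B := Z.mod_pos_bound x 8 ltac:(lia)). lia.
Qed.

(** The square of an integer modulo 16 depends only on the integer modulo 8, so the test on residues
    covers every zero. *)
Lemma diag4_dyadicP a b c d : diag4_dyadic a b c d = true -> anisotropic a b c d.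
Proof.
  intros H. apply (anisotropic_descent 2); [lia|]. intros x y z t E. unfold diag4_dyadic in H.
  apply (all_residuesP _ x), (all_residuesP _ y), (all_residuesP _ z), (all_residuesP _ t) in H.
  assert (S : forall u, exists k, u ^ 2 = (u mod 8) ^ 2 + k * 16).
  { intros u. exists (4 * (u / 8) ^ 2 + (u / 8) * (u mod 8)).
    rewrite (Z.div_mod u 8) at 1 by lia. ring. }
  assert (M : diag4 a b c d (x mod 8) (y mod 8) (z mod 8) (t mod 8) mod 16 = 0).
  { apply Z.mod_divide; [lia|]. unfold diag4 in *.
    destruct (S x) as [i Hi], (S y) as [j Hj], (S z) as [k Hk], (S t) as [l Hl].
    exists (- (a * i + b * j + c * k + d * l)). rewrite Hi, Hj, Hk, Hl in E.
    apply Z.sub_move_0_r. rewrite <- E. ring. }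
  cbv beta in H. rewrite M in H. cbn [Z.eqb] in H. rewrite !andb_true_iff in H.
  assert (V : forall u, Z.even (u mod 8) = true -> (2 | u)).
  { intros u Hu. apply Z.even_spec in Hu. destruct Hu as [k Hk].
    exists (k + 4 * (u / 8)). rewrite (Z.div_mod u 8) at 1 by lia. lia. }
  destruct H as [[[Hx Hy] Hz] Ht]. auto.
Qed.

(** For [p] other than 2, the six tests run over the choices of the two coefficients divisible by
    [p]. *)
Definition certificate (p a b c d : Z) : bool :=
  let a := strip 20 p a in let b := strip 20 p b in
  let c := strip 20 p c in let d := strip 20 p d in
  if p =? 2 then diag4_dyadic a b c d else
  if diag4_primal p a b c d then true else if diag4_primal p a c b d then true else
  if diag4_primal p a d b c then true else if diag4_primal p c d a b then true else
  if diag4_primal p b d a c then true else diag4_primal p b c a d.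

Lemma certificateP p a b c d : 1 < p -> invertible_residues p = true ->
  certificate p a b c d = true -> anisotropic a b c d.
Proof.
  intros p1 I H. unfold certificate in H. cbv zeta in H.
  destruct (strip_spec p a 20 p1) as [i [i0 Hi]], (strip_spec p b 20 p1) as [j [j0 Hj]],
    (strip_spec p c 20 p1) as [k [k0 Hk]], (strip_spec p d 20 p1) as [l [l0 Hl]].
  apply (anisotropic_scale _ _ _ _ _ _ _ _ i j k l i0 j0 k0 l0 Hi Hj Hk Hl).
  revert H. generalize (strip 20 p a), (strip 20 p b), (strip 20 p c), (strip 20 p d).
  intros a' b' c' d' H. destruct (p =? 2); [now apply diag4_dyadicP|].
  assert (R : forall (u v : bool), (if u then true else v) = true -> u = true \/ v = true)
    by (intros [] []; auto).
  repeat (apply R in H; destruct H as [H|H]); apply (diag4_primalP p _ _ _ _ p1 I) in H;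
    intros x y z t E; unfold anisotropic, diag4 in *.
  - now apply H.
  - destruct (H x z y t) as [? [? [? ?]]]; [etransitivity; [|exact E]; ring|auto].
  - destruct (H x t y z) as [? [? [? ?]]]; [etransitivity; [|exact E]; ring|auto].
  - destruct (H z t x y) as [? [? [? ?]]]; [etransitivity; [|exact E]; ring|auto].
  - destruct (H y t x z) as [? [? [? ?]]]; [etransitivity; [|exact E]; ring|auto].
  - destruct (H y z x t) as [? [? [? ?]]]; [etransitivity; [|exact E]; ring|auto].
Qed.

(** * Ternary forms spanned by vectors of values 8, 12 and [n], with polar values [b], [c], [d] *)

Definition ternary (n b c d x y z : Z) : Z :=
  8 * x ^ 2 + 12 * y ^ 2 + n * z ^ 2 + b * (x * y) + c * (x * z) + d * (y * z).

Definition allowed (m : Z) : bool := (m =? 0) || (6 <? m) && ((m mod 6 =? 0) || (m mod 6 =? 2)).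

Definition small : list Z := [0; 1; -1; 2; -2].

Definition small_values_allowed (n b c d : Z) : bool :=
  every (fun z => every (fun y => every (fun x => allowed (ternary n b c d x y z)) small) small) small.

(* Pairs of a prime [p] and a value [e] such that [ternary n b c d - e t ^ 2] is anisotropic
   over the [p]-adic numbers; found by computer search. *)
Definition obstructions : list (Z * Z) :=
  [(3, 36); (3, 24); (5, 60); (5, 20); (13, 156); (11, 44); (19, 38); (59, 236); (37, 444);
   (53, 636); (83, 332); (2, 26); (2, 36); (2, 60); (17, 68); (71, 1562)].

(** Leading minors of orders 2 and 3 of the Gram matrix of the polar form, whose rows are (16, b,
    c), (b, 24, d), (c, d, 2n). *)
Definition disc2 (b : Z) : Z := 384 - b ^ 2.
Definition disc3 (n b c d : Z) : Z := 768 * n + 2 * b * c * d - 16 * d ^ 2 - 24 * c ^ 2 - 2 * n * b ^ 2.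

(** Completing squares diagonalizes [32 * disc2 b] times the form by a triangular substitution with
    nonzero diagonal, so anisotropy carries back. *)
Lemma ternary_anisotropic n b c d e : disc2 b <> 0 ->
  anisotropic (disc2 b) 1 (disc3 n b c d) (- 2 * disc2 b * e) ->
  forall x y z t, ternary n b c d x y z = e * t ^ 2 -> x = 0 /\ y = 0 /\ z = 0 /\ t = 0.
Proof.
  intros D H x y z t E.
  destruct (H (16 * x + b * y + c * z) (disc2 b * y + (16 * d - b * c) * z) (4 * z) (4 * t))
    as [Hx [Hy [Hz Ht]]].
  { transitivity (32 * disc2 b * (ternary n b c d x y z - e * t ^ 2)); [|rewrite E; ring].
    unfold diag4, disc3, disc2, ternary. ring. }
  assert (z = 0) by lia. assert (t = 0) by lia. subst z t.
  rewrite Z.mul_0_r, Z.add_0_r in Hy. apply Z.mul_eq_0 in Hy. lia.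
Qed.

Definition range (k : nat) : list Z := map (fun i => Z.of_nat i - Z.of_nat k) (seq 0 (2 * k + 1)).

Lemma in_range k x : - Z.of_nat k <= x <= Z.of_nat k -> In x (range k).
Proof.
  intros H. apply in_map_iff. exists (Z.to_nat (x + Z.of_nat k)). split; [lia|].
  apply in_seq. lia.
Qed.

(** Chosen so that the third vector is independent of the first two. If 12 divides [b], the binary
    form takes only multiples of 4, hence not 14. The other admissible cases are [b = 6] and
    [b = -6], where 14 is a value already but 18 is not. *)
Definition third_value (b : Z) : Z := if b mod 12 =? 0 then 14 else 18.

Definition obstructed3 (n b c d : Z) : bool :=
  if small_values_allowed n b c d then
    if disc2 b =? 0 then false else
    some (fun pe => certificate (fst pe) (disc2 b) 1 (disc3 n b c d) (- 2 * disc2 b * snd pe))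
      obstructions
  else true.

Definition obstructed2 (b : Z) : bool :=
  if every (fun x => every (fun y => allowed (ternary 0 b 0 0 x y 0)) small) small then
    every (fun c => every (obstructed3 (third_value b) b c) (range 30)) (range 26)
  else true.

(** The ranges contain all coefficients that can occur: nonnegativity on sums and differences of two
    basis vectors bounds [b], [c], [d] by 8 + 12, 8 + 18 and 12 + 18. *)
Lemma all_obstructed : every obstructed2 (range 20) = true.
Proof. vm_compute. reflexivity. Qed.

Definition valid_obstruction (pe : Z * Z) : bool :=
  (1 <? fst pe) && invertible_residues (fst pe) && allowed (snd pe) && (0 <? snd pe).

Lemma obstructions_valid : every valid_obstruction obstructions = true.
Proof. vm_compute. reflexivity. Qed.

Lemma allowed_spec m :
  allowed m = true <-> m = 0 \/ 6 < m /\ exists k, m = 6 * k \/ m = 6 * k + 2.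
Proof.
  unfold allowed. rewrite orb_true_iff, andb_true_iff, orb_true_iff, !Z.eqb_eq, Z.ltb_lt.
  assert (D := Z.div_mod m 6 ltac:(lia)). assert (B := Z.mod_pos_bound m 6 ltac:(lia)). split.
  - intros [?|[? ?]]; [now left|right]. split; [lia|exists (m / 6)]. lia.
  - intros [?|[? [k ?]]]; [now left|right]. split; lia.
Qed.

Lemma allowed_ge0 m : allowed m = true -> 0 <= m.
Proof.
  unfold allowed. rewrite orb_true_iff, andb_true_iff, Z.eqb_eq, Z.ltb_lt. lia.
Qed.

(** The quantifiers follow the order in which the vectors are picked: [n] may depend on the first
    two only, [e] on all three. *)
Theorem ternary_obstruction b : (forall x y, allowed (ternary 0 b 0 0 x y 0) = true) ->
  exists n, (n = 14 \/ n = 18) /\ forall c d,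
    (forall x y z, allowed (ternary n b c d x y z) = true) ->
    exists e, (0 < e /\ allowed e = true) /\
      forall x y z t, ternary n b c d x y z = e * t ^ 2 -> x = 0 /\ y = 0 /\ z = 0 /\ t = 0.
Proof.
  intros H2. exists (third_value b).
  assert (N : third_value b = 14 \/ third_value b = 18) by (unfold third_value; destruct (_ =? _); auto).
  split; [exact N|]. intros c d H3.
  assert (B : In b (range 20)).
  { apply in_range. assert (P := allowed_ge0 _ (H2 1 1)). assert (Q := allowed_ge0 _ (H2 1 (-1))).
    unfold ternary in P, Q. lia. }
  assert (C := proj1 (everyP _ _ _) all_obstructed b B). unfold obstructed2 in C.
  replace (every _ small) with true in C.
  2:{ symmetry. apply everyP. intros x _. apply everyP. intros y _. apply H2. }
  assert (Cc : In c (range 26)).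
  { apply in_range. assert (P := allowed_ge0 _ (H3 1 0 1)). assert (Q := allowed_ge0 _ (H3 1 0 (-1))).
    unfold ternary in P, Q. lia. }
  assert (Cd : In d (range 30)).
  { apply in_range. assert (P := allowed_ge0 _ (H3 0 1 1)). assert (Q := allowed_ge0 _ (H3 0 1 (-1))).
    unfold ternary in P, Q. lia. }
  rewrite everyP in C. specialize (C c Cc).
  rewrite everyP in C. specialize (C d Cd). unfold obstructed3 in C.
  replace (small_values_allowed _ b c d) with true in C.
  2:{ symmetry. unfold small_values_allowed. apply everyP. intros z _. apply everyP. intros y _.
      apply everyP. intros x _. apply H3. }
  destruct (Z.eqb_spec (disc2 b) 0) as [D|D]; [discriminate|].
  apply someP in C. destruct C as [[p e] [I K]]. cbn [fst snd] in K.
  assert (O := proj1 (everyP _ _ _) obstructions_valid _ I). unfold valid_obstruction in O.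
  cbn [fst snd] in O.
  rewrite !andb_true_iff, !Z.ltb_lt in O. destruct O as [[[p1 Ip] Ae] e0].
  exists e. split; [auto|]. apply ternary_anisotropic; [exact D|].
  exact (certificateP p _ _ _ _ p1 Ip K).
Qed.

End TernaryObstruction.

From mathcomp Require Import all_boot all_order all_algebra all_fingroup all_solvable all_field.
From mathcomp Require Import ring zify ssrZ.
Set Implicit Arguments.
Unset Strict Implicit.
Unset Printing Implicit Defensive.
Import Order.TTheory GRing.Theory Num.Theory.
Local Open Scope ring_scope.

(** * Quadratic reciprocity *)

(** The Legendre symbol by Euler's criterion, integer-valued so that symbols for different primes
    can be multiplied. *)
Definition qchar (p : nat) (x : 'F_p) : int :=
  let y := x ^+ p.-1./2 in if y == 0 then 0 else if y == 1 then 1 else -1.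

Section Legendre.
Variables (p : nat).
Hypotheses (pp : prime p) (op : odd p).

Lemma Fp_two_neq0 : (2 : 'F_p) != 0.
Proof.
rewrite -(dvdn_pcharf (pchar_Fp pp)); apply/negP => /(dvdn_leq (isT : 0 < 2)%N).
by have := prime_gt1 pp; move: op; case: (p) => [|[|[|k]]].
Qed.

Lemma halfK_pred_odd : (p.-1./2 * 2 = p.-1)%N.
Proof. by rewrite muln2 even_halfK //; move: op; case: (p) => //= k; rewrite oddS. Qed.

Lemma Fp_fermat (x : 'F_p) : x != 0 -> x ^+ p.-1 = 1.
Proof.
move=> x0; apply: (mulfI x0); rewrite -exprS prednK ?prime_gt0 // mulr1.
by have := expf_card x; rewrite card_Fp.
Qed.

Lemma half_pow_cases (x : 'F_p) : x != 0 ->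
  (x ^+ p.-1./2 == 1) || (x ^+ p.-1./2 == -1).
Proof.
move=> x0; rewrite -eqf_sqr expr1n -exprM halfK_pred_odd.
by rewrite Fp_fermat.
Qed.

Lemma Fp_one_neq_opp1 : (1 : 'F_p) != -1.
Proof. by rewrite eq_sym -subr_eq0 -opprD oppr_eq0 (_ : 1 + 1 = 2) // Fp_two_neq0. Qed.

Lemma half_pred_gt0 : (0 < p.-1./2)%N.
Proof.
by have := halfK_pred_odd; have := prime_gt1 pp; move: op; lia.
Qed.

Lemma qchar_Fp (x : 'F_p) : (qchar x)%:~R = x ^+ p.-1./2.
Proof.
rewrite /qchar; case: eqP => [-> //|/eqP y0]; case: eqP => [-> //|/eqP y1].
have x0 : x != 0.
  by apply: contraNneq y0 => ->; rewrite expr0n eqn0Ngt half_pred_gt0.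
by have := half_pow_cases x0; rewrite (negbTE y1) /= => /eqP ->.
Qed.

Lemma qchar_values (x : 'F_p) : [\/ qchar x = 0, qchar x = 1 | qchar x = -1].
Proof. by rewrite /qchar; case: eqP => _; [|case: eqP => _]; constructor. Qed.

Lemma qchar0 : qchar (0 : 'F_p) = 0.
Proof. by rewrite /qchar expr0n eqn0Ngt half_pred_gt0 eqxx. Qed.

Lemma qchar_eq0 (x : 'F_p) : (qchar x == 0) = (x == 0).
Proof.
by rewrite /qchar expf_eq0 half_pred_gt0 /=; case: (x == 0) => //; case: (_ == 1).
Qed.

(** The values 0, 1, -1 stay distinct modulo an odd prime, so identities between symbols can be
    checked in ['F_p]. *)
Lemma sign_inj_Fp (a b : int) :
  [\/ a = 0, a = 1 | a = -1] -> [\/ b = 0, b = 1 | b = -1] ->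
  a%:~R = b%:~R :> 'F_p -> a = b.
Proof.
have z2 := Fp_one_neq_opp1.
have z3 : (-1 : 'F_p) != 0 by rewrite oppr_eq0.
case=> ->; case=> -> //; rewrite ?mulr0z ?mulr1z ?mulrN1z => e01.
- by case/eqP: z3.
- by case/eqP: z2.
- by case/eqP: z3.
- by case/eqP: z2.
Qed.

Lemma qcharM (x y : 'F_p) : qchar (x * y) = qchar x * qchar y.
Proof.
apply: sign_inj_Fp; first exact: qchar_values.
  by case: (qchar_values x) => ->; case: (qchar_values y) => ->; constructor.
by rewrite intrM !qchar_Fp exprMn.
Qed.

Lemma qchar1 : qchar (1 : 'F_p) = 1.
Proof. by rewrite /qchar expr1n oner_eq0 eqxx. Qed.

Lemma qchar_sqr (x : 'F_p) : x != 0 -> qchar (x ^+ 2) = 1.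
Proof.
by rewrite expr2 qcharM -qchar_eq0; case: (qchar_values x) => ->.
Qed.

Lemma qcharN1 : qchar (-1 : 'F_p) = (-1) ^+ p.-1./2.
Proof.
apply: sign_inj_Fp; first exact: qchar_values.
  by rewrite -signr_odd; case: (odd _); constructor.
by rewrite qchar_Fp rmorphXn /= mulrN1z.
Qed.

Lemma Fp_prim_elt : exists g : 'F_p, forall x, x != 0 -> exists i, x = g ^+ i.
Proof.
have /cyclicP[g Hg] := field_unit_group_cyclic [set: {unit 'F_p}]%G.
exists (val g) => x x0; have ux : x \is a GRing.unit by rewrite unitfE.
have : FinRing.Unit ux \in <[g]>%g by rewrite -Hg inE.
by case/cycleP => i Hi; exists i; have := congr1 val Hi; rewrite /= FinRing.val_unitX.
Qed.

Lemma nonresidue : exists2 a : 'F_p, a != 0 & qchar a = -1.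
Proof.
have [/forallP Hall|] := boolP [forall a : 'F_p, (a != 0) ==> (qchar a == 1)]; last first.
  rewrite negb_forall => /existsP[a]; rewrite negb_imply => /andP[a0 qa]; exists a => //.
  by move: a0 qa; rewrite -qchar_eq0; case: (qchar_values a) => ->.
(* otherwise X^((p-1)/2) - 1 would have p - 1 roots *)
exfalso; pose P : {poly 'F_p} := 'X^(p.-1./2) - 1%:P.
have sP : size P = (p.-1./2).+1 by rewrite size_XnsubC // half_pred_gt0.
have P0 : P != 0 by rewrite -size_poly_eq0 sP.
pose s := [seq a <- enum 'F_p | a != 0].
have us : uniq s by rewrite filter_uniq ?enum_uniq.
have rs : all (root P) s.
  apply/allP => a; rewrite mem_filter => /andP[a0 _].
  have := Hall a; rewrite a0 => /eqP qa.
  by rewrite /root /P !hornerE -qchar_Fp qa subrr.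
have := max_poly_roots P0 rs us; rewrite sP ltnS.
have -> : size s = p.-1.
  rewrite -(card_uniqP us).
  have := cardC1 (0 : 'F_p); rewrite card_Fp // => <-.
  by apply: eq_card => a; rewrite !inE mem_filter mem_enum andbT.
by have := halfK_pred_odd; have := half_pred_gt0; lia.
Qed.

(** A generator has symbol -1, since otherwise no element would; so [x] is an even power of it. *)
Lemma qchar_sqrt (x : 'F_p) : qchar x = 1 -> exists y, x = y ^+ 2.
Proof.
move=> q1; have x0 : x != 0 by rewrite -qchar_eq0 q1.
have [g Hg] := Fp_prim_elt; have [i Hi] := Hg x x0.
have [a a0 qa] := nonresidue; have [j Hj] := Hg a a0.
have gX (k : nat) : qchar (g ^+ k) = qchar g ^+ k.
  by elim: k => [|k IH]; rewrite ?expr0 ?qchar1 // !exprS qcharM IH.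
have g1 : qchar g = -1.
  case: (qchar_values g) => // qg; move: qa; rewrite Hj gX qg ?expr1n //.
  by case: (j) => [|k]; rewrite ?expr0 ?expr0n.
move: q1; rewrite Hi gX g1 -signr_odd; case oi: (odd i) => // _.
by exists (g ^+ i./2); rewrite -exprM muln2 even_halfK // oi.
Qed.

(** Multiplication by a nonresidue permutes the terms and changes their signs. *)
Lemma sum_qchar : \sum_(x : 'F_p) qchar x = 0.
Proof.
have [a a0 qa] := nonresidue; set S := \sum_x _.
have : S = - S.
  rewrite {1}/S (reindex_inj (mulfI a0)) /= /S -sumrN.
  by apply: eq_bigr => x _; rewrite qcharM qa mulN1r.
lia.
Qed.
End Legendre.

Lemma intr_pchar_eq0 (p : nat) (R : nzRingType) (a : int) : p \in [pchar R] ->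
  (a%:~R == 0 :> R) = (p%:Z %| a)%Z.
Proof.
move=> cp; rewrite dvdzE /= (dvdn_pcharf cp).
by case: a => m; rewrite ?NegzE ?abszN ?mulrNz ?oppr_eq0 // -pmulrn.
Qed.

Lemma intr_Fp_eq0 (p : nat) (a : int) : prime p ->
  (a%:~R == 0 :> 'F_p) = (p%:Z %| a)%Z.
Proof. by move=> pp; apply: intr_pchar_eq0; apply: pchar_Fp. Qed.

(** * Gauss sums and the reciprocity law *)

Section GaussSum.
Variables (p : nat) (K : fieldType) (z : K).
Hypotheses (pp : prime p) (op : odd p) (zp : z ^+ p = 1) (z1 : z != 1).

Let e (t : 'F_p) : K := z ^+ t.
Let chi (t : 'F_p) : K := (qchar t)%:~R.
Let g : K := \sum_t chi t * e t.

(** Arithmetic in ['F_p] reduces modulo this expression, which equals [p] only through [Fp_cast]. *)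
Let zFp : z ^+ (Zp_trunc (pdiv p)).+2 = 1. Proof. by rewrite Fp_cast. Qed.

Let eD s t : e (s + t) = e s * e t.
Proof.
by rewrite /e -exprD /= (expr_mod _ zFp).
Qed.

Let e0 : e 0 = 1. Proof. by rewrite /e expr0. Qed.

Let e1 : e 1 = z.
Proof. by rewrite /e /= modn_small ?expr1 // Fp_cast ?prime_gt1. Qed.

Let sum_e : \sum_t e t = 0.
Proof.
have : (\sum_t e t) * (z - 1) = 0.
  rewrite mulrBr mulr1 -e1 mulr_suml [X in _ - X](reindex_inj (addIr (1 : 'F_p))) /=.
  by apply/eqP; rewrite subr_eq0; apply/eqP/eq_bigr => t _; rewrite eD.
by move/eqP; rewrite mulf_eq0 subr_eq0 (negbTE z1) orbF => /eqP.
Qed.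

Let sum_e_scaled (a : 'F_p) : a != 0 -> \sum_t e (t * a) = 0.
Proof. by move=> a0; rewrite -[RHS]sum_e [RHS](reindex_inj (mulIf a0)). Qed.

(** With [t = s * u] the double sum has terms [chi u * e (s * (1 + u))]. Summing over nonzero [s]
    gives [p - 1] if [u = -1] and -1 otherwise; since [chi] sums to 0, only [p * chi (-1)]
    remains. *)
Lemma gauss_sum_sqr : g ^+ 2 = ((-1) ^+ p.-1./2 * p%:R : int)%:~R.
Proof.
have chiM s t : chi (s * t) = chi s * chi t by rewrite /chi qcharM // intrM.
have chi0 : chi 0 = 0 by rewrite /chi qchar0.
rewrite expr2 {1}/g mulr_suml (bigD1 0) //= chi0 !mul0r add0r.
transitivity (\sum_(s | s != 0) \sum_u chi u * e (s * (1 + u))).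
  apply: eq_bigr => s s0; rewrite /g mulr_sumr (reindex_inj (mulfI s0)) /=.
  apply: eq_bigr => u _; rewrite mulrDr mulr1 eD chiM.
  have ss : chi s * chi s = 1 by rewrite -chiM -expr2 /chi qchar_sqr //.
  by rewrite -[RHS]mul1r -ss; ring.
rewrite exchange_big /=.
transitivity (\sum_u (chi u * (p%:R * (u == -1)%:R) - chi u)).
  apply: eq_bigr => u _; rewrite -mulr_sumr -[X in _ - X]mulr1 -mulrBr; congr (_ * _).
  have [->|u1] := eqVneq u (-1).
    rewrite mulr1 (eq_bigr (fun=> 1)) => [|s _]; last by rewrite subrr mulr0 e0.
    rewrite sumr_const -(natrB _ (prime_gt0 pp)).
    have := cardC1 (0 : 'F_p); rewrite card_Fp // subn1 => <-.
    by congr (_ *+ _); apply: eq_card.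
  rewrite mulr0 sub0r; apply/eqP; rewrite -subr_eq0 opprK addrC; apply/eqP.
  rewrite -[X in X + _]e0 -(mul0r (1 + u)) -(bigD1 (P := xpredT) (F := fun s => e (s * (1 + u))) 0) //=.
  by rewrite sum_e_scaled // addrC addr_eq0.
rewrite sumrB (bigD1 (-1)) //= eqxx mulr1 big1 => [|u /negbTE->]; last by rewrite !mulr0.
rewrite addr0 /chi -(rmorph_sum _ _ _ (fun u => qchar u)) /= sum_qchar // subr0 qcharN1 //.
by rewrite rmorphM /= rmorph_nat.
Qed.

(** In characteristic [q], Frobenius fixes the signs [chi t] and sends [e t] to [e (q * t)];
    reindexing by [q] pulls out its symbol. *)
Lemma gauss_sum_Frobenius (q : nat) : prime q -> odd q -> q != p -> q \in [pchar K] ->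
  g ^+ q = (qchar (q%:R : 'F_p))%:~R * g.
Proof.
move=> qp oq qNp cq.
have chiM s t : chi (s * t) = chi s * chi t by rewrite /chi qcharM // intrM.
have q0 : (q%:R : 'F_p) != 0.
  by rewrite -(dvdn_pcharf (pchar_Fp pp)) dvdn_prime2 // eq_sym.
have chiq : chi q%:R * chi q%:R = 1 by rewrite -chiM -expr2 /chi qchar_sqr //.
rewrite -(pFrobenius_autE cq) {1}/g rmorph_sum /= /g mulr_sumr [RHS](reindex_inj (mulIf q0)) /=.
apply: eq_bigr => t _; rewrite pFrobenius_autE exprMn chiM mulrA [_ * (chi t * _)]mulrCA chiq mulr1.
congr (_ * _).
  rewrite /chi -rmorphXn /=; case: (qchar_values t) => ->.
  - by rewrite expr0n; move: oq; case: (q).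
  - by rewrite expr1n.
  - by rewrite -signr_odd oq.
by rewrite /e -exprM /= (expr_mod _ zFp) val_Fp_nat // -(expr_mod _ zp) modnMmr expr_mod.
Qed.
End GaussSum.

(** By Fermat, [p] divides the order of the unit group of the field with [q ^ p.-1] elements;
    Cauchy's theorem applies. *)
Lemma prim_root_in_char (p q : nat) : prime p -> prime q -> p != q ->
  exists (K : fieldType) (z : K), [/\ q \in [pchar K], z ^+ p = 1 & z != 1].
Proof.
move=> pp qp pNq.
have p1 : (0 < p.-1)%N by have := prime_gt1 pp; lia.
have [K cK oK] := PrimePowerField qp p1.
have dvdp : (p %| #|[set: {unit K}]|)%N.
  rewrite card_finField_unit oK.
  have : (q ^ p.-1 = 1 %[mod p])%N.
    rewrite -(totient_prime pp) Euler_exp_totient // coprime_sym prime_coprime //.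
    by rewrite dvdn_prime2.
  move/eqP; rewrite eqn_mod_dvd ?expn_gt0 ?prime_gt0 //.
  by rewrite subn1.
have [u _ ou] := Cauchy pp dvdp.
exists K, (val u); split => //.
  by rewrite -FinRing.val_unitX -ou expg_order.
apply: contraTneq (prime_gt1 pp) => u1.
by rewrite -ou (_ : u = 1%g) ?order1 //; apply: val_inj.
Qed.

(** Compare two values of [g ^+ q]: Frobenius gives the symbol of [q] modulo [p], and the power of
    [g ^+ 2] gives Euler's criterion modulo [q]. *)
Theorem quadratic_reciprocity (p q : nat) :
  prime p -> odd p -> prime q -> odd q -> q != p ->
  qchar (((-1) ^+ p.-1./2 * p%:R : int)%:~R : 'F_q) = qchar (q%:R : 'F_p).
Proof.
move=> pp op qp oq qNp.
have [|K [z [cK zp z1]]] := prim_root_in_char pp qp; first by rewrite eq_sym.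
have := gauss_sum_sqr pp op zp z1; have := gauss_sum_Frobenius pp op zp qp oq qNp cK.
set g := (\sum_t _); set c : int := (-1) ^+ _ * _ => gq g2.
have c0 : ~~ (q%:Z %| c)%Z.
  by rewrite dvdzE /= /c abszM abszX /= exp1n mul1n natz /= dvdn_prime2.
have g0 : g != 0.
  by apply: contraNneq c0 => g0; rewrite -(intr_pchar_eq0 c cK) -g2 g0 expr0n.
have cq : (c%:~R : K) ^+ q.-1./2 = (qchar (q%:R : 'F_p))%:~R.
  apply: (mulIf g0); rewrite -gq -g2 -exprM -exprSr; congr (_ ^+ _).
  by rewrite mulnC halfK_pred_odd // prednK ?prime_gt0.
apply: (sign_inj_Fp qp oq); [exact: qchar_values|exact: qchar_values|].
rewrite qchar_Fp //; apply/eqP; rewrite -rmorphXn /= -subr_eq0 -intrB intr_Fp_eq0 //.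
by rewrite -(intr_pchar_eq0 _ cK) intrB rmorphXn /= cq subrr.
Qed.

(** * Kronecker symbols *)

(** For odd [d], the nontrivial character modulo 4. *)
Definition odd_sign (d : nat) : int := (-1) ^+ d./2.

Lemma odd_signM a b : odd a -> odd b -> odd_sign (a * b) = odd_sign a * odd_sign b.
Proof.
move=> oa ob; rewrite /odd_sign -exprD -signr_odd -[RHS]signr_odd; congr ((-1) ^+ nat_of_bool _).
by have := odd_double_half a; have := odd_double_half b; rewrite oa ob; lia.
Qed.

Lemma odd_sign_prod (s : seq nat) : all odd s ->
  \prod_(r <- s) odd_sign r = odd_sign (\prod_(r <- s) r)%N.
Proof.
elim: s => [|r s IH] /=; first by rewrite !big_nil.
move=> /andP[or os]; rewrite !big_cons odd_signM ?IH //.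
by elim: s os {IH} => [|t s IH] /=; rewrite ?big_nil // big_cons oddM => /andP[-> /IH].
Qed.

Lemma odd_prod (s : seq nat) : all odd s -> odd (\prod_(r <- s) r)%N.
Proof. by elim: s => [|t s IH] /=; rewrite ?big_nil // big_cons oddM => /andP[-> /IH]. Qed.

(* The Kronecker symbol (-n/d), for n the product of [s]. *)
Definition kron (s : seq nat) (d : nat) : int :=
  if odd d then odd_sign d * \prod_(r <- s) qchar (d%:R : 'F_r) else 0.

Section Kronecker.
Variables (s : seq nat) (n : nat).
Hypotheses (ps : all prime s) (os : all odd s) (ns : n = (\prod_(r <- s) r)%N) (n4 : (n %% 4 = 1)%N).

Let chi := kron s.

Let psr r : r \in s -> prime r. Proof. exact: (allP ps). Qed.
Let osr r : r \in s -> odd r. Proof. exact: (allP os). Qed.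

Lemma kron1 : chi 1 = 1.
Proof.
rewrite /chi /kron /= /odd_sign expr0 mul1r big_seq big1 // => r rs.
exact: qchar1.
Qed.

Lemma kronM a b : chi (a * b) = chi a * chi b.
Proof.
rewrite /chi /kron oddM; case oa: (odd a) => /=; last by rewrite mul0r.
case ob: (odd b); last by rewrite mulr0.
rewrite odd_signM // mulrACA -big_split /=; congr (_ * _).
apply: eq_big_seq => r rs; rewrite natrM qcharM //; [exact: psr|exact: osr].
Qed.

Lemma kron_period d : chi (d + 4 * n) = chi d.
Proof.
rewrite /chi /kron oddD oddM /= addbF; case od: (odd d) => //; congr (_ * _).
  rewrite /odd_sign -signr_odd -[RHS]signr_odd; congr ((-1) ^+ nat_of_bool _); lia.
apply: eq_big_seq => r rs; rewrite natrD natrM.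
have -> : (n%:R : 'F_r) = 0.
  apply/eqP; rewrite -(dvdn_pcharf (pchar_Fp (psr rs))) ns (big_rem r rs) /=.
  exact: dvdn_mulr.
by rewrite mulr0 addr0.
Qed.

Lemma kron_values d : [\/ chi d = 0, chi d = 1 | chi d = -1].
Proof.
rewrite /chi /kron; case: (odd d); last by constructor.
have: [\/ \prod_(r <- s) qchar (d%:R : 'F_r) = 0, \prod_(r <- s) qchar (d%:R : 'F_r) = 1
        | \prod_(r <- s) qchar (d%:R : 'F_r) = -1].
  elim: s => [|r t IH]; first by rewrite big_nil; constructor.
  by rewrite big_cons; case: (qchar_values (d%:R : 'F_r)) => ->; case: IH => ->; constructor.
by rewrite /odd_sign -signr_odd; case=> ->; case: (odd _); constructor.
Qed.

Lemma kron_neq0 d : (chi d != 0) = coprime d (4 * n).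
Proof.
rewrite coprimeMr (_ : coprime d 4 = odd d); last by rewrite -(coprimen2 d) -(@coprime_pexpr 2 d 2).
rewrite /chi /kron; case: (odd d) => //=.
rewrite mulf_eq0 negb_or signr_eq0 /= ns.
elim: s ps os => [|r t IH] /=; first by rewrite !big_nil coprimen1.
move=> /andP[pr pt] /andP[or ot]; rewrite !big_cons mulf_eq0 negb_or IH //.
rewrite coprimeMr [coprime d r]coprime_sym (prime_coprime d pr); congr (~~ _ && _).
by rewrite qchar_eq0 // -(dvdn_pcharf (pchar_Fp pr)).
Qed.

Lemma n_odd : odd n. Proof. by rewrite ns odd_prod. Qed.

Lemma odd_sign_n : odd_sign n = 1.
Proof. rewrite /odd_sign -signr_odd (_ : odd n./2 = false) //; lia. Qed.

Lemma prod_qcharN1 : \prod_(r <- s) qchar (-1 : 'F_r) = 1.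
Proof.
transitivity (\prod_(r <- s) odd_sign r); last by rewrite odd_sign_prod // -ns odd_sign_n.
apply: eq_big_seq => r rs.
rewrite qcharN1 ?psr ?osr // /odd_sign; congr (_ ^+ _).
by have := osr rs; case: (r) => //= k; rewrite uphalf_half; case: (odd k).
Qed.

(** The character modulo 4 changes sign, while the symbols of -1 at the primes of [s] multiply to 1
    because [n] is 1 modulo 4. *)
Lemma kron_opp d : (d <= 4 * n)%N -> chi (4 * n - d) = - chi d.
Proof.
move=> dn; rewrite /chi /kron oddB // oddM /=; case od: (odd d); last by rewrite oppr0.
have -> : odd_sign (4 * n - d) = - odd_sign d.
  rewrite /odd_sign -signr_odd -[in RHS]signr_odd.
  have -> : odd (4 * n - d)./2 = ~~ odd d./2 by lia.
  by case: (odd _).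
rewrite mulNr; congr (- (_ * _)); rewrite -[RHS]mul1r -[X in X * _]prod_qcharN1 -big_split /=.
apply: eq_big_seq => r rs; rewrite -qcharM ?psr ?osr // natrB // mulN1r; congr qchar.
rewrite natrM (_ : (n%:R : 'F_r) = 0) ?mulr0 ?sub0r //.
apply/eqP; rewrite -(dvdn_pcharf (pchar_Fp (psr rs))) ns (big_rem r rs) /=.
exact: dvdn_mulr.
Qed.

(** This class is 1 modulo 4 and -1 modulo [n]; the modulus [m] of the three-square theorem is
    sought in it. *)
Lemma kron_2n1 : chi (2 * n - 1) = 1.
Proof.
rewrite /chi /kron; have -> : odd (2 * n - 1) by lia.
rewrite (_ : odd_sign _ = 1) ?mul1r; last first.
  by rewrite /odd_sign -signr_odd (_ : odd _ = false) //; lia.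
rewrite -[RHS]prod_qcharN1; apply: eq_big_seq => r rs; congr qchar.
rewrite natrB; last by have := n_odd; lia.
rewrite natrM (_ : (n%:R : 'F_r) = 0) ?mulr0 ?sub0r //.
apply/eqP; rewrite -(dvdn_pcharf (pchar_Fp (psr rs))) ns (big_rem r rs) /=.
exact: dvdn_mulr.
Qed.

(** Since [odd_sign n = 1], [n] is the product of the signed primes [odd_sign r * r], and
    reciprocity applies to each. *)
Lemma kron_prime p : prime p -> odd p -> ~~ (p %| n)%N ->
  chi p = qchar ((- n%:Z)%:~R : 'F_p).
Proof.
move=> pp op pn; rewrite /chi /kron op -mulN1r intrM qcharM //.
have -> : (-1)%:~R = -1 :> 'F_p by rewrite mulrN1z.
rewrite qcharN1 //; congr (_ * _).
  by rewrite /odd_sign; congr (_ ^+ _); move: op; case: (p) => //= k; rewrite uphalf_half; case: (odd k).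
have -> : n%:Z = \prod_(r <- s) (odd_sign r * r%:Z).
  rewrite big_split /= odd_sign_prod // -ns odd_sign_n mul1r ns.
  by elim: s => [|r t IH]; rewrite ?big_nil // !big_cons PoszM IH.
rewrite rmorph_prod /=.
have -> (F : nat -> 'F_p) : qchar (\prod_(r <- s) F r) = \prod_(r <- s) qchar (F r).
  by elim: s => [|r t IH]; rewrite ?big_nil ?qchar1 // !big_cons qcharM ?IH.
apply: eq_big_seq => r rs.
have rNp : p != r.
  by apply: contraNneq pn => ->; rewrite ns (big_rem r rs) /= dvdn_mulr.
rewrite -(quadratic_reciprocity (psr rs) (osr rs) pp op rNp); congr (qchar _%:~R).
rewrite natz /odd_sign; congr (_ ^+ _ * _).
by have := osr rs; case: (r) => //= k; rewrite uphalf_half; case: (odd k).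
Qed.
End Kronecker.

(** * The hyperbola method *)

Lemma ler_norm_sum_nat (f : nat -> int) u v : (forall i, `|f i| <= 1) ->
  `|\sum_(u <= i < v) f i| <= (v - u)%:Z.
Proof.
move=> f1; apply: le_trans (ler_norm_sum _ _ _) _.
rewrite -[leRHS]natz -sumr_const_nat; exact: ler_sum.
Qed.

Section PeriodicSums.
Variables (N : nat) (N0 : (0 < N)%N) (f : nat -> int).
Hypothesis fN : forall i, f (i + N)%N = f i.

Lemma periodic_mod i : f (i %% N)%N = f i.
Proof.
rewrite [in RHS](divn_eq i N) addnC; elim: (i %/ N)%N => [|q IH]; first by rewrite mul0n addn0.
by rewrite mulSn addnCA addnC fN.
Qed.

Lemma periodic_block u : \sum_(u <= i < u + N) f i = \sum_(0 <= i < N) f i.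
Proof.
elim: u => [|u IH]; first by rewrite add0n.
rewrite -IH addSn big_nat_recr /=; last by rewrite -{1}(addn0 u) ltn_add2l.
rewrite fN addrC [RHS]big_ltn // -{1}(addn0 u) ltn_add2l //.
Qed.

Lemma periodic_sum u k :
  \sum_(u <= i < u + k) f i =
    (\sum_(0 <= i < N) f i) * (k %/ N)%:Z + \sum_(u + k %/ N * N <= i < u + k) f i.
Proof.
have kN := leq_trunc_div k N.
rewrite (@big_cat_nat _ _ _ (u + k %/ N * N)) ?leq_addr ?leq_add2l //=; congr (_ + _).
elim: (k %/ N)%N => [|q IH]; first by rewrite mul0n addn0 mulr0 big_geq.
rewrite mulSn [(N + _)%N]addnC addnA (@big_cat_nat _ _ _ (u + q * N)) ?leq_addr //=.
by rewrite IH (periodic_block (u + q * N)) intS mulrDr mulr1 addrC.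
Qed.

Lemma periodic_sum0 u v : \sum_(0 <= i < N) f i = 0 -> (forall i, `|f i| <= 1) ->
  `|\sum_(u <= i < v) f i| <= N%:Z.
Proof.
move=> s0 f1; have [uv|/ltnW vu] := leqP u v; last by rewrite big_geq.
rewrite -(subnKC uv) periodic_sum s0 mul0r add0r.
apply: le_trans (ler_norm_sum_nat _ _ f1) _; rewrite lez_nat.
by have := ltn_pmod (v - u) N0; have := divn_eq (v - u) N; lia.
Qed.

(** Each full period contributes 1, and the incomplete one 0 or 1. *)
Lemma periodic_sum1 u v : (u <= v)%N -> \sum_(0 <= i < N) f i = 1 -> (forall i, 0 <= f i) ->
  `|N%:Z * \sum_(u <= i < v) f i - (v - u)%:Z| <= N%:Z.
Proof.
move=> uv s1 f0; rewrite -{1}(subnKC uv) periodic_sum s1 mul1r.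
set w := (u + _)%N; set R := \sum_(w <= i < _) _; set k := (v - u)%N in w R *.
have R0 : 0 <= R by apply: sumr_ge0.
have R1 : R <= 1.
  rewrite -s1 -(periodic_block w) (@big_cat_nat _ _ _ (u + k) w (w + N)) /=; last 2 first.
  - by rewrite leq_add2l leq_trunc_div.
  - by rewrite /w -addnA leq_add2l -mulSnr ltnW // ltn_ceil.
  by rewrite lerDl sumr_ge0.
have kE := divn_eq k N; have kr := ltn_pmod k N0.
have [->|->] : R = 0 \/ R = 1 by lia.
  by rewrite addr0 -PoszM; lia.
by rewrite mulrDr mulr1 -PoszM; lia.
Qed.
End PeriodicSums.

Definition divsum (chi : nat -> int) (m : nat) : int := \sum_(d <- divisors m) chi d.

Lemma divsumE chi m x : (0 < m <= x)%N ->
  divsum chi m = \sum_(1 <= d < x.+1) \sum_(1 <= e < x.+1 | (d * e == m)%N) chi d.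
Proof.
move=> /andP[m0 mx]; transitivity (\sum_(1 <= d < x.+1 | (d %| m)%N) chi d).
  rewrite /divsum -[RHS]big_filter; apply: perm_big; apply: uniq_perm.
  - exact: divisors_uniq.
  - by rewrite filter_uniq // iota_uniq.
  move=> d; rewrite mem_filter mem_index_iota -dvdn_divisors // andbC ltnS.
  have [dm|] := boolP (d %| m)%N; last by rewrite andbF.
  by rewrite (dvdn_gt0 m0 dm) (leq_trans (dvdn_leq m0 dm) mx).
rewrite big_mkcond; apply: eq_big_nat => d /andP[d0 dx].
case: ifP => dm.
  rewrite (eq_bigl (fun e => e == m %/ d)%N); last first.
    by move=> e /=; rewrite mulnC -eqn_div.
  by rewrite big_nat1_eq divn_gt0 // dvdn_leq //= ltnS (leq_trans (leq_div _ _) mx).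
by rewrite big1 // => e /eqP de; move: dm; rewrite -de dvdn_mulr.
Qed.

Lemma sum_divsum chi x (P : pred nat) :
  \sum_(1 <= m < x.+1 | P m) divsum chi m =
  \sum_(1 <= d < x.+1) \sum_(1 <= e < x.+1 | (d * e <= x)%N && P (d * e)%N) chi d.
Proof.
transitivity (\sum_(1 <= m < x.+1 | P m) \sum_(1 <= d < x.+1) \sum_(1 <= e < x.+1 | (d * e == m)%N) chi d).
  rewrite big_nat_cond [RHS]big_nat_cond; apply: eq_bigr => m /andP[mx _]; exact: divsumE.
rewrite exchange_big /=; apply: eq_big_nat => d /andP[d0 dx].
rewrite (exchange_big_dep_nat (fun e => (d * e <= x)%N && P (d * e)%N)) /=; last first.
  by move=> m e /andP[m0 mx] _ Pm /eqP ->; rewrite Pm andbT.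
rewrite big_nat_cond [RHS]big_nat_cond; apply: eq_bigr => e /andP[/andP[e0 ex] /andP[dex Pde]].
rewrite (eq_bigl (fun m => m == d * e)%N); last first.
  by move=> m /=; rewrite eq_sym; case: eqP => [->|]; rewrite ?Pde ?andbF.
by rewrite big_nat1_eq muln_gt0 d0 e0 ltnS dex.
Qed.

(** Lattice points under [d * e <= y * y] are split at [d = y]; beyond it [e <= y], so the long
    inner sum always runs over the other variable. *)
Lemma hyperbola chi y (P : pred nat) :
  \sum_(1 <= m < (y * y).+1 | P m) divsum chi m =
  \sum_(1 <= d < y.+1) \sum_(1 <= e < (y * y %/ d).+1 | P (d * e)%N) chi d
  + \sum_(1 <= e < y.+1) \sum_(y.+1 <= d < (y * y %/ e).+1 | P (d * e)%N) chi d.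
Proof.
set x := (y * y)%N; have yx : (y.+1 <= x.+1)%N by rewrite /x; nia.
rewrite sum_divsum (@big_cat_nat _ _ _ y.+1) //=; congr (_ + _).
  apply: eq_big_nat => d /andP[d0 dx].
  rewrite [RHS](big_nat_widen _ _ x.+1) ?ltnS ?leq_div //.
  by apply: eq_bigl => e; rewrite ltnS leq_divRL // mulnC andbC.
rewrite (exchange_big_dep_nat (fun e => e < y.+1)%N) /=; last first.
  by move=> d e /andP[dy _] /andP[e0 _] _ /andP[de _]; rewrite ltnS; move: dy de; rewrite /x; nia.
rewrite [RHS](big_nat_widen _ _ x.+1) //= big_nat_cond [RHS]big_nat_cond.
apply: eq_bigr => e /andP[/andP[e0 ex] ey].
rewrite [RHS](big_nat_widen _ _ x.+1) ?ltnS ?leq_div //.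
by apply: eq_bigl => d; rewrite ltnS leq_divRL // andbC.
Qed.

Section Equidistribution.
Variables (N : nat) (chi : nat -> int) (a : nat).
Hypotheses (N0 : (0 < N)%N) (chi_val : forall d, [\/ chi d = 0, chi d = 1 | chi d = -1]).
Hypotheses (chiM : forall d e, chi (d * e)%N = chi d * chi e).
Hypotheses (chi_per : forall d, chi (d + N)%N = chi d).
Hypotheses (chi_cop : forall d, (chi d != 0) = coprime d N).
Hypotheses (chi_sum : \sum_(0 <= d < N) chi d = 0) (chi_a : chi a = 1).

Let chi1 d : `|chi d| <= 1. Proof. by case: (chi_val d) => ->. Qed.

Let cong_a (m : nat) : int := (m == a %[mod N])%N.

Let sum_cong d : coprime d N -> \sum_(0 <= i < N) cong_a (d * i) = 1.
Proof.
move=> dN; have ca : coprime a N by rewrite -chi_cop chi_a.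
have [u Hu] : exists u, (d * u = 1 %[mod N])%N.
  (* [egcdnP] requires [d] positive; [d = 0] is coprime to [N] only if [N = 1]. *)
  have d0N : (0 < d)%N || (N == 1)%N.
    by rewrite lt0n; move: dN; case: (d) => // /eqP; rewrite gcd0n => ->.
  case/orP: d0N => [d0|/eqP ->]; last by exists 0%N; rewrite !modn1.
  case: (egcdnP N d0) => u k; move: dN; rewrite /coprime => /eqP -> Hk _; exists u.
  by rewrite mulnC Hk -modnDml modnMl.
pose i0 := (u * a %% N)%N.
rewrite (eq_big_nat _ _ (F2 := fun i => (i == i0)%:Z)); last first.
  move=> i /andP[_ iN]; rewrite /cong_a; congr (Posz (nat_of_bool _)); apply/eqP/eqP.
    move=> Hi; rewrite -(modn_small iN) /i0 -[in LHS](mul1n i) -modnMml -Hu modnMml.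
    by rewrite mulnAC -modnMml Hi modnMml mulnC.
  by move=> ->; rewrite /i0 modnMmr mulnA -modnMml Hu modnMml mul1n.
transitivity (\sum_(0 <= i < N | i == i0) (1 : int)); last by rewrite big_nat1_eq /= ltn_pmod.
by rewrite [RHS]big_mkcond; apply: eq_bigr => i _; case: eqP.
Qed.

(** The whole sum is [A] up to error. In the class of [a], each half of the hyperbola sum,
    multiplied by [N], is at least [A] up to error: this half-plane symmetry gives the factor 2. The
    errors add up to [2 * 1 + 1 + 2 = 5] times [N * y]. *)
Lemma equidistribution y :
  2 * \sum_(1 <= m < (y * y).+1) divsum chi m <=
  N%:Z * \sum_(1 <= m < (y * y).+1 | (m == a %[mod N])%N) divsum chi m + 5 * N%:Z * y%:Z.
Proof.
set x := (y * y)%N.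
pose A : int := \sum_(1 <= d < y.+1) chi d * (x %/ d)%:Z.
have sumN (F : nat -> int) : (forall e, (1 <= e < y.+1)%N -> F e <= N%:Z) ->
    \sum_(1 <= e < y.+1) F e <= N%:Z * y%:Z.
  move=> HF; rewrite big_nat_cond; apply: le_trans (_ : \sum_(1 <= e < y.+1) N%:Z <= _).
    by rewrite [leRHS]big_nat_cond; apply: ler_sum => e /andP[/HF].
  by rewrite sumr_const_nat subSS subn0 -mulr_natr natz.
(* For fixed [e] the sum of [chi d] over [d > y] cancels up to [N]. *)
have B1 : \sum_(1 <= m < x.+1) divsum chi m <= A + N%:Z * y%:Z.
  rewrite (hyperbola chi y xpredT) -/x lerD //.
    rewrite /A le_eqVlt; apply/orP; left; apply/eqP/eq_bigr => d _.
    by rewrite sumr_const_nat subSS subn0 -mulr_natr natz.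
  apply: sumN => e _; apply: le_trans (ler_norm _) _; exact: periodic_sum0.
(* For [d] coprime to [N] the condition selects one class of [e] modulo [N]; for other [d] both
   terms vanish. *)
have B2 : A - N%:Z * y%:Z <= N%:Z * \sum_(1 <= d < y.+1)
    \sum_(1 <= e < (x %/ d).+1 | (d * e == a %[mod N])%N) chi d.
  rewrite lerBlDr -lerBlDl mulr_sumr -sumrB; apply: sumN => d _.
  have [cd|] := boolP (coprime d N); last first.
    rewrite -chi_cop negbK => /eqP ->; rewrite big1 // !mul0r mulr0 subr0 //.
  have -> : \sum_(1 <= e < (x %/ d).+1 | (d * e == a %[mod N])%N) chi d =
     chi d * \sum_(1 <= e < (x %/ d).+1) cong_a (d * e).
    rewrite mulr_sumr big_mkcond; apply: eq_bigr => e _; rewrite /cong_a.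
    by case: eqP; rewrite ?mulr1 ?mulr0.
  have := @periodic_sum1 N N0 (fun e => cong_a (d * e)) _ 1 (x %/ d).+1 isT (sum_cong cd).
  rewrite subSS subn0 => H.
  have {}H : `|N%:Z * (\sum_(1 <= e < (x %/ d).+1) cong_a (d * e)) - (x %/ d)%:Z| <= N%:Z.
    apply: H => [e|e]; last by rewrite /cong_a.
    by rewrite /cong_a mulnDr -modnDmr modnMl addn0.
  by case: (chi_val d) => ->; lia.
(* From [chi (d * e) = chi a = 1] follows [chi d = chi e], so the summand no longer depends on [d]
   and the argument of [B2] applies. The second [N * y] pays for the missing [d <= y]. *)
have B3 : A - 2 * N%:Z * y%:Z <= N%:Z * \sum_(1 <= e < y.+1)
    \sum_(y.+1 <= d < (x %/ e).+1 | (d * e == a %[mod N])%N) chi d.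
  have Y : y%:Z * \sum_(1 <= e < y.+1) chi e <= N%:Z * y%:Z.
    rewrite mulrC ler_wpM2r //; apply: le_trans (ler_norm _) _; exact: periodic_sum0.
  suff : \sum_(1 <= e < y.+1) (chi e * ((x %/ e)%:Z - y%:Z) -
      N%:Z * \sum_(y.+1 <= d < (x %/ e).+1 | (d * e == a %[mod N])%N) chi d) <= N%:Z * y%:Z.
    rewrite sumrB -mulr_sumr; under eq_bigr do rewrite mulrBr.
    rewrite sumrB -/A -mulr_suml; move: Y; set U : int := \sum_(1 <= e < y.+1) chi e.
    by set W : int := \sum_(1 <= i < y.+1) _; move: (A) (U) (W) => A1 U1 W1; lia.
  apply: sumN => e /andP[e0 ey].
  have [ce|nce] := boolP (coprime e N); last first.
    have := nce; rewrite -chi_cop negbK => /eqP ->; rewrite big1 ?mul0r ?mulr0 ?subr0 //.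
    move=> d /eqP dea; case/negP: nce; have : coprime (d * e) N.
      by rewrite -coprime_modl dea coprime_modl -chi_cop chi_a.
    by rewrite coprimeMl => /andP[].
  have -> : \sum_(y.+1 <= d < (x %/ e).+1 | (d * e == a %[mod N])%N) chi d =
     chi e * \sum_(y.+1 <= d < (x %/ e).+1) cong_a (e * d).
    rewrite mulr_sumr big_mkcond; apply: eq_bigr => d _; rewrite /cong_a [(e * d)%N]mulnC.
    case: eqP => [de|_]; rewrite ?mulr1 ?mulr0 //.
    have : chi (d * e) = 1.
      by rewrite -(periodic_mod chi_per) de (periodic_mod chi_per).
    by rewrite chiM; case: (chi_val d) => ->; case: (chi_val e) => ->.
  have ye : (y <= x %/ e)%N by rewrite leq_divRL // /x leq_mul2l -ltnS ey orbT.
  have := @periodic_sum1 N N0 (fun d => cong_a (e * d)) _ y.+1 (x %/ e).+1 ye (sum_cong ce).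
  rewrite subSS => H.
  have {}H : `|N%:Z * (\sum_(y.+1 <= d < (x %/ e).+1) cong_a (e * d)) - (x %/ e - y)%:Z| <= N%:Z.
    apply: H => [d|d]; last by rewrite /cong_a.
    by rewrite /cong_a mulnDr -modnDmr modnMl addn0.
  by case: (chi_val e) => ->; lia.
rewrite [X in _ <= _ * X + _](hyperbola chi y (fun m => m == a %[mod N])%N) -/x mulrDr.
move: B1 B2 B3; set S : int := \sum_(1 <= m < x.+1) _.
set U : int := \sum_(1 <= d < y.+1) \sum_(1 <= e < _ | _) _.
set V : int := \sum_(1 <= e < y.+1) _; move: (A) (S) (U) (V) => A1 S1 U1 V1; lia.
Qed.
End Equidistribution.

(** * Divisor sums of a completely multiplicative function with values 0, 1, -1 *)

Section DivisorSums.
Variable chi : nat -> int.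
Hypotheses (chi_val : forall d, [\/ chi d = 0, chi d = 1 | chi d = -1]).
Hypotheses (chi_1 : chi 1%N = 1) (chiM : forall d e, chi (d * e)%N = chi d * chi e).

(** Divisors prime to [p] are those of [m]; the others are [p] times the divisors of [p ^ k * m]. *)
Lemma divsum_primeM p k m : prime p -> (0 < m)%N -> ~~ (p %| m)%N ->
  divsum chi (p ^ k.+1 * m) = divsum chi m + chi p * divsum chi (p ^ k * m).
Proof.
move=> pp m0 pm; have p0 := prime_gt0 pp.
have pk j : (0 < p ^ j * m)%N by rewrite muln_gt0 expn_gt0 p0.
rewrite /divsum (bigID (fun d => p %| d)%N) /= addrC; congr (_ + _).
  rewrite -big_filter; apply: perm_big; apply: uniq_perm; rewrite ?filter_uniq ?divisors_uniq //.
  move=> d; rewrite mem_filter -!dvdn_divisors //.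
  apply/andP/idP => [[pd] | dm].
    by rewrite Gauss_dvdr // coprimeXr // coprime_sym prime_coprime.
  split; last exact: dvdn_mull.
  by apply: contra pm => pd; apply: dvdn_trans pd dm.
rewrite mulr_sumr -big_filter.
transitivity (\sum_(d <- [seq p * d | d <- divisors (p ^ k * m)]%N) chi d).
  apply: perm_big; apply: uniq_perm; rewrite ?filter_uniq ?map_inj_uniq ?divisors_uniq //.
    by move=> d e /eqP; rewrite eqn_pmul2l // => /eqP.
  move=> d; rewrite mem_filter -dvdn_divisors //.
  apply/andP/mapP => [[/dvdnP[e ->]] | [e]].
    rewrite expnS -mulnA [(e * p)%N]mulnC dvdn_pmul2l // => He.
    by exists e => //; rewrite -dvdn_divisors.
  by rewrite -dvdn_divisors // => He ->; rewrite dvdn_mulr // expnS -mulnA dvdn_pmul2l.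
by rewrite big_map; apply: eq_bigr => d _; rewrite chiM.
Qed.

Lemma divsum_primeXM p k m : prime p -> (0 < m)%N -> ~~ (p %| m)%N ->
  divsum chi (p ^ k * m) =
    (if chi p == 1 then k.+1%:Z else if chi p == 0 then 1 else (~~ odd k)%:Z) * divsum chi m.
Proof.
move=> pp m0 pm; elim: k => [|k IH].
  by rewrite mul1n; case: (chi_val p) => ->; rewrite /= mul1r.
rewrite divsum_primeM // IH; case: (chi_val p) => -> /=; last by case: (odd k) => /=; ring.
  by ring.
by rewrite !intS; ring.
Qed.

Lemma divsum_ge0 m : (0 < m)%N -> 0 <= divsum chi m.
Proof.
elim/ltn_ind: m => m IH m0; have [m1|m1] := leqP m 1.
  have -> : m = 1%N by lia.
  by rewrite /divsum big_seq1 chi_1.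
have pp := pdiv_prime m1; have [m' pm'] := pfactor_coprime pp m0.
rewrite mulnC => mE; have m'0 : (0 < m')%N by move: m0; rewrite mE muln_gt0 => /andP[].
have lt : (m' < m)%N.
  rewrite mE -[X in (X < _)%N]mul1n ltn_pmul2r //.
  have l0 : (0 < logn (pdiv m) m)%N by rewrite logn_gt0 mem_primes pp m0 pdiv_dvd.
  by rewrite -(expn0 (pdiv m)) ltn_exp2l // prime_gt1.
rewrite mE divsum_primeXM //; last by rewrite -prime_coprime.
by rewrite mulr_ge0 ?IH //; case: eqP => // _; case: eqP.
Qed.

Lemma divsum_ge1 m : (0 < m)%N -> (forall d, (d %| m)%N -> 0 <= chi d) -> 1 <= divsum chi m.
Proof.
move=> m0 H; rewrite /divsum (big_rem 1%N) /=; last by rewrite -dvdn_divisors // dvd1n.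
rewrite chi_1 lerDl big_seq sumr_ge0 // => d /mem_rem; rewrite -dvdn_divisors // => /H //.
Qed.

Lemma chi_dvd_ge0 m : (0 < m)%N -> (forall p, prime p -> (p %| m)%N -> 0 <= chi p) ->
  forall d, (d %| m)%N -> 0 <= chi d.
Proof.
move=> m0 H; elim/ltn_ind => d IH dm; have d0 := dvdn_gt0 m0 dm.
have [d1|d1] := leqP d 1; first by have -> : d = 1%N by [lia]; rewrite chi_1.
have pd := pdiv_dvd d; have pp := pdiv_prime d1.
rewrite -(divnK pd) chiM; apply: mulr_ge0; last by apply: H => //; apply: dvdn_trans dm.
apply: IH; first by rewrite ltn_Pdiv // prime_gt1.
by apply: dvdn_trans dm; apply/dvdnP; exists (pdiv d); rewrite mulnC divnK.
Qed.

(* Where the divisor sum is positive, the primes with [chi p = -1] occur to even powers. *)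
Lemma divsum_gt0_sqrt (n m : nat) : (0 < m)%N ->
  (forall p, prime p -> (p %| m)%N -> chi p = 1 -> exists b, (p %| b ^ 2 + n)%N) ->
  (forall p, prime p -> (p %| m)%N -> chi p != 0) ->
  0 < divsum chi m -> exists k m' b : nat, m = (k ^ 2 * m')%N /\ (m' %| b ^ 2 + n)%N.
Proof.
elim/ltn_ind: m => m IH m0 Hsq Hn0; have [m1|m1] := leqP m 1.
  by exists 1%N, 1%N, 0%N; split; [lia|rewrite dvd1n].
have pp := pdiv_prime m1; have [m' pm'] := pfactor_coprime pp m0.
have pm := pdiv_dvd m; move: pp pm pm'; set p := pdiv m => pp pm pm'.
rewrite mulnC; set l := logn p m => mE.
have m'0 : (0 < m')%N by move: m0; rewrite mE muln_gt0 => /andP[].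
have l0 : (0 < l)%N by rewrite logn_gt0 mem_primes pp m0 pdiv_dvd.
have lt : (m' < m)%N.
  by rewrite mE -[X in (X < _)%N]mul1n ltn_pmul2r // -(expn0 p) ltn_exp2l // prime_gt1.
have m'm : (m' %| m)%N by rewrite mE dvdn_mull.
have pNm' : ~~ (p %| m')%N by rewrite -prime_coprime.
rewrite mE divsum_primeXM // => r0.
have [|||k [m1' [b [kE bE]]]] := IH m' lt m'0.
- by move=> r pr rm' c1; apply: Hsq => //; apply: dvdn_trans m'm.
- by move=> r pr rm'; apply: Hn0 => //; apply: dvdn_trans m'm.
- rewrite lt_def divsum_ge0 // andbT; apply: contraTneq r0 => ->; by rewrite mulr0.
(* An even power of [p] is absorbed into the square. *)
case ol : (odd l); last first.
  exists (p ^ l./2 * k)%N, m1', b; split => //.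
  by rewrite kE expnMn -expnM muln2 even_halfK ?ol // mulnA.
(* For odd [l] the local factor vanishes when [chi p = -1], and [chi p = 0] is excluded by
   hypothesis. *)
have c1 : chi p = 1.
  by move: r0 (Hn0 p pp pm); rewrite ol; case: (chi_val p) => -> //=; rewrite mul0r.
have [b0 pb0] := Hsq p pp pm c1.
have cop : coprime p m1'.
  by rewrite prime_coprime //; apply: contra pNm' => pm1; rewrite kE dvdn_mull.
(* One factor [p] stays in the modulus; the square roots of [-n] modulo [p] and [m1'] are glued. *)
exists (p ^ l./2 * k)%N, (p * m1')%N, (chinese p m1' b0 b); split.
  rewrite kE expnMn -expnM muln2 -[in LHS](odd_double_half l) ol expnD expn1; ring.
have aux (u c c' : nat) : (c = c' %[mod u] -> (u %| c' ^ 2 + n) -> u %| c ^ 2 + n)%N.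
  by move=> cc'; rewrite /dvdn -modnDml -modnXm -cc' modnXm modnDml.
rewrite Gauss_dvd //; apply/andP; split.
  by apply: aux pb0; rewrite chinese_modl.
by apply: aux bE; rewrite chinese_modr.
Qed.
End DivisorSums.

(** * Existence of the modulus for the three-square theorem *)

Lemma prime_seq_prod n : (0 < n)%N -> exists2 s, all prime s & n = (\prod_(r <- s) r)%N.
Proof.
elim/ltn_ind: n => n IH n0; have [n1|n1] := leqP n 1.
  by exists [::]; rewrite ?big_nil //; lia.
have pp := pdiv_prime n1; have pd := pdiv_dvd n.
have [||s ps sE] := IH (n %/ pdiv n)%N.
- by rewrite ltn_Pdiv // prime_gt1.
- by rewrite divn_gt0 ?prime_gt0 // dvdn_leq.
by exists (pdiv n :: s); rewrite /= ?pp // big_cons -sE mulnC divnK.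
Qed.

Lemma ler_sum_uniq (f : nat -> int) (L : seq nat) x : uniq L ->
  (forall m, m \in L -> (0 < m <= x)%N && (1 <= f m)) ->
  (forall m, (0 < m)%N -> 0 <= f m) ->
  (size L)%:Z <= \sum_(1 <= m < x.+1) f m.
Proof.
move=> uL HL f0; rewrite (bigID (mem L)) /= -[leLHS]addr0 lerD //; last first.
  by rewrite big_nat_cond sumr_ge0 // => m /andP[/andP[m0 _] _]; exact: f0.
rewrite -big_filter (perm_big L) /=; last first.
  apply: uniq_perm; rewrite ?filter_uniq ?iota_uniq // => m.
  rewrite mem_filter mem_index_iota ltnS; case: (boolP (m \in L)) => //= mL.
  by case/andP: (HL m mL).
have -> : (size L)%:Z = \sum_(m <- L) 1 by rewrite big_const_seq count_predT iter_addr_0 natz.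
by rewrite big_seq [leRHS]big_seq ler_sum // => m /HL/andP[].
Qed.

Lemma modn_eq_dvd_succ n m : (0 < n)%N -> (m = 2 * n - 1 %[mod 4 * n])%N -> (n %| m + 1)%N.
Proof.
move=> n0 mE; have : (m = 2 * n - 1 %[mod n])%N.
  by rewrite -(@modn_dvdm (4 * n)) ?dvdn_mull // mE modn_dvdm ?dvdn_mull.
move=> H; rewrite /dvdn -modnDml H modnDml subnK; last by lia.
by rewrite modnMl.
Qed.

(* A modulus [m] coprime to [2n], [m = -1] modulo [n] up to a square factor [k ^ 2],
   to which [-n] is a quadratic residue; it replaces the prime that Dirichlet's theorem
   supplies in the usual proof of the three-square theorem. *)
Lemma residue_modulus n : (0 < n)%N -> (n %% 4 = 1)%N ->
  exists k m b : nat, [/\ (0 < m)%N, (n %| k ^ 2 * m + 1)%N & (m %| b ^ 2 + n)%N].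
Proof.
move=> n0 n4; have [s ps sE] := prime_seq_prod n0.
have os : all odd s.
  apply/allP => r rs; have : (r %| n)%N by rewrite sE (big_rem r rs) /= dvdn_mulr.
  case/dvdnP => c nE; move: n4; rewrite nE; case: (boolP (odd r)) => // /negPf er.
  by have := odd_double_half r; rewrite er; lia.
pose chi := kron s; pose N := (4 * n)%N.
have N0 : (0 < N)%N by rewrite /N; lia.
have cv := kron_values s.
have c1 : chi 1%N = 1 := kron1 s.
have cM : forall d e, chi (d * e)%N = chi d * chi e := kronM ps os.
have cP d : chi (d + N)%N = chi d := kron_period ps os sE n4 d.
have c0 d : (chi d != 0) = coprime d N := kron_neq0 ps os sE d.
have c00 : chi 0%N = 0 by [].
(* The reflection [d -> N - d] changes the sign of [chi]; the sum is taken up to [N] included so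
   that it is a bijection. *)
have cS : \sum_(0 <= d < N) chi d = 0.
  have : \sum_(0 <= d < N.+1) chi d = - \sum_(0 <= d < N.+1) chi d.
    rewrite {1}big_nat_rev /= -sumrN; apply: eq_big_nat => d /andP[_ dN].
    by rewrite add0n subSS; apply: (kron_opp ps os sE n4).
  by rewrite big_nat_recr //= -(add0n N) cP c00 addr0 add0n; move: (\sum_(_ <= _ < _) _) => X; lia.
have cA : chi (2 * n - 1)%N = 1 := kron_2n1 ps os sE n4.
have cp p : prime p -> chi p != 0 -> chi p = qchar ((- n%:Z)%:~R : 'F_p).
  move=> pp; rewrite c0 coprimeMr prime_coprime // prime_coprime // => /andP[p4 pn].
  apply: (kron_prime ps os sE n4) => //.
  by rewrite -[odd p]negbK -dvdn2; apply: contra p4 => p2; case: (even_prime pp) => [->//|]; lia.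
have op p : prime p -> chi p != 0 -> odd p.
  by move=> pp; rewrite /chi /kron; case: (odd p).
(* [L] lists [K * U] numbers [u ^ 2 + n * 4 ^ j] up to [y * y]. Modulo a prime divisor [p] with
   [chi p] nonzero, [-n] is the square of [u / 2 ^ j], so their divisor sums are at least 1. With
   [K = 8 * N], the bound [2 * K * U = 16 * N * U] beats the error [5 * N * y = 15 * N * U]. *)
pose K := (8 * N)%N; pose U := (n * 4 ^ K)%N; pose y := (3 * U)%N.
have U0 : (0 < U)%N by rewrite muln_gt0 n0 expn_gt0.
pose L := [seq (u ^ 2 + n * 4 ^ j)%N | j <- iota 0 K, u <- iota U.+1 U].
have jU j : (j < K)%N -> (n * 4 ^ j <= U)%N by move=> jK; rewrite leq_mul2l leq_exp2l // ltnW ?orbT.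
have S1 : (K * U)%:Z <= \sum_(1 <= m < (y * y).+1) divsum chi m.
  have -> : (K * U)%N = size L by rewrite size_allpairs !size_iota.
  apply: ler_sum_uniq; last exact: (divsum_ge0 cv c1 cM).
    apply: allpairs_uniq; rewrite ?iota_uniq // => -[j u] [j' u'] /=.
    case/allpairsP => -[j1 u1] /= [+ + [-> ->]].
    rewrite !mem_iota /= => Hj Hu.
    case/allpairsP => -[j2 u2] /= [+ + [-> ->]].
    rewrite !mem_iota /= => Hj' Hu' E.
    have J1 := jU j1 Hj; have J2 := jU j2 Hj'.
    (* [n * 4 ^ j <= U < u] puts the number strictly below [(u + 1) ^ 2], so it determines [u]. *)
    have uu : u1 = u2 by move: J1 J2 E Hu Hu'; rewrite -!mulnn; move: (n * 4 ^ j1)%N (n * 4 ^ j2)%N; nia.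
    move: E; rewrite uu => /eqP; rewrite eqn_add2l eqn_pmul2l // eqn_exp2l // => /eqP ->.
    by [].
  move=> m /allpairsP[[j u] /= [+ + ->]]; rewrite !mem_iota /= => Hj Hu.
  have J := jU j Hj; apply/andP; split.
    by rewrite /y -!mulnn; move: J Hu; move: (n * 4 ^ j)%N; nia.
  have m0 : (0 < u ^ 2 + n * 4 ^ j)%N by rewrite -mulnn; nia.
  apply: (divsum_ge1 c1) => //; apply: (chi_dvd_ge0 c1 cM) => // p pp pm.
  have [->//|cp0] := eqVneq (chi p) 0.
  have cpN : coprime p (4 * n) by rewrite -c0.
  have pNn : ~~ (p %| n)%N.
    by rewrite -prime_coprime //; move: cpN; rewrite coprimeMr => /andP[].
  have pN2 : coprime p (2 ^ j).
    by rewrite coprimeXr // coprimen2 (op p pp cp0).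
  have w0 : ((2 ^ j)%:R : 'F_p) != 0.
    by rewrite -(dvdn_pcharf (pchar_Fp pp)) -prime_coprime.
  have nE : ((- n%:Z)%:~R : 'F_p) = (u%:R / (2 ^ j)%:R) ^+ 2.
    move: pm; rewrite (dvdn_pcharf (pchar_Fp pp)) natrD natrM natrX.
    rewrite (_ : (4 ^ j)%N = ((2 ^ j) ^ 2)%N); last by rewrite -expnM mulnC expnM.
    rewrite natrX addr_eq0 => /eqP uE; rewrite expr_div_n uE -mulNr mulfK ?expf_neq0 //.
    by rewrite mulrNz -pmulrn.
  rewrite cp // nE qchar_sqr ?(op p pp cp0) //.
  by rewrite -(sqrf_eq0) -nE intr_Fp_eq0 // dvdzE abszN.
have S2 := equidistribution N0 cv cM cP c0 cS cA y; move: S1 S2.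
set S : int := \sum_(1 <= m < (y * y).+1) _; set Sa : int := \sum_(1 <= m < _ | _) _.
move=> S1 S2; have Sa0 : 0 < Sa.
  have : 5 * N%:Z * y%:Z < 2 * S.
    apply: lt_le_trans (_ : 2 * (K * U)%:Z <= _); last by rewrite ler_pM2l.
    by rewrite /y /K !PoszM; move: N0 U0; clear; nia.
  by move: S2 N0; clear; nia.
have [m /andP[/andP[m0 mx] mE] rm] : exists2 m, ((0 < m)%N && (m <= y * y)%N) && (m == 2 * n - 1 %[mod N])%N & 0 < divsum chi m.
  have [/hasP[m]|H] := boolP (has (fun m => (m == 2 * n - 1 %[mod N])%N && (0 < divsum chi m)) (index_iota 1 (y * y).+1)).
    by rewrite mem_index_iota ltnS => mi /andP[mE rm]; exists m => //; rewrite mi.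
  exfalso; move: Sa0; rewrite ltNge => /negP; apply; rewrite /Sa big_nat_cond.
  apply: sumr_le0 => m /andP[/andP[m0 mx] mE]; rewrite leNgt; apply: contra H => rm.
  by apply/hasP; exists m; rewrite ?mem_index_iota ?m0 ?mE.
have mN : coprime m (4 * n).
  by rewrite -c0 -(periodic_mod cP) (eqP mE) (periodic_mod cP) cA.
have nz p : prime p -> (p %| m)%N -> chi p != 0.
  by move=> pp pm; rewrite c0; apply: coprime_dvdl pm mN.
have [|k [m' [b [mE' bE]]]] := @divsum_gt0_sqrt chi cv c1 cM n m m0 _ nz rm.
  move=> p pp pm cp1; have := cp p pp (nz p pp pm); rewrite cp1 => /esym/(qchar_sqrt pp (op p pp (nz p pp pm)))[w wE].
  exists (w : nat); rewrite (dvdn_pcharf (pchar_Fp pp)) natrD natrX natr_Zp -wE.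
  by rewrite mulrNz -pmulrn addNr.
exists k, m', b; split=> //; last by rewrite -mE'; apply: modn_eq_dvd_succ => //; exact/eqP.
by move: m0; rewrite mE' muln_gt0 => /andP[].
Qed.

(** * Sums of three squares *)

(* The Gram matrix [[a, f, e], [f, b, d], [e, d, c]] is that of three vectors of Z^3. *)
Definition gram_in_Z3 (a b c d e f : int) : Prop :=
  exists u v w : int * int * int,
    let dot (s t : int * int * int) := s.1.1 * t.1.1 + s.1.2 * t.1.2 + s.2 * t.2 in
    [/\ dot u u = a, dot v v = b & dot w w = c] /\ [/\ dot v w = d, dot u w = e & dot u v = f].

(** The base change replacing [w] by [w - t * v], undone on vectors of Z^3. *)
Lemma gram_in_Z3_translate a b c d e f t :
  gram_in_Z3 a b (c - 2 * t * d + t ^+ 2 * b) (d - t * b) (e - t * f) f ->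
  gram_in_Z3 a b c d e f.
Proof.
case=> -[[u1 u2] u3] [[[v1 v2] v3] [[[w1 w2] w3]]] /= [[ha hb hc] [hd he hf]].
exists (u1, u2, u3), (v1, v2, v3), (w1 + t * v1, w2 + t * v2, w3 + t * v3) => /=.
have hd' : d = v1 * w1 + v2 * w2 + v3 * w3 + t * b by rewrite hd; ring.
have he' : e = u1 * w1 + u2 * w2 + u3 * w3 + t * f by rewrite he; ring.
have hc' : c = w1 * w1 + w2 * w2 + w3 * w3 + 2 * t * d - t ^+ 2 * b by rewrite hc; ring.
by rewrite hc' hd' he' -ha -hb -hf; split; split; ring.
Qed.

Lemma gram_in_Z3_swap12 a b c d e f : gram_in_Z3 a c b d f e -> gram_in_Z3 a b c d e f.
Proof.
case=> u [v [w]] [[ha hb hc] [hd he hf]]; exists u, w, v; split; split=> //=.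
by rewrite -hd /=; ring.
Qed.

Lemma gram_in_Z3_swap01 a b c d e f : gram_in_Z3 b a c e d f -> gram_in_Z3 a b c d e f.
Proof.
case=> u [v [w]] [[ha hb hc] [hd he hf]]; exists v, u, w; split; split=> //=.
by rewrite -hf /=; ring.
Qed.

Lemma centered_residue (B P : int) : 0 < P -> exists t, 2 * `|B - t * P| <= P.
Proof.
move=> P0; exists ((2 * B + P) %/ (2 * P))%Z.
have P2 : 2 * P != 0 by lia.
have := divz_eq (2 * B + P) (2 * P); have := modz_ge0 (2 * B + P) P2.
by have := @ltz_pmod (2 * B + P) (2 * P); move: ((_ %/ _)%Z) ((_ %% _)%Z); nia.
Qed.

Lemma sqr_le_of_double (r p : int) : 2 * `|r| <= p -> 4 * (r * r) <= p * p.
Proof.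
move=> H; have -> : 4 * (r * r) = (2 * `|r|) * (2 * `|r|).
  by rewrite mulrACA -normrM -expr2 ger0_norm ?sqr_ge0 ?expr2.
by apply: ler_pM => //; rewrite mulr_ge0.
Qed.

(** Reduction of positive ternary forms of determinant 1, by induction on the entry [a] and, within
    it, on the minor [a * b - f ^+ 2]. *)
Lemma unimodular_in_Z3 (A P : nat) (a b c d e f : int) :
  a = A%:Z -> a * b - f ^+ 2 = P%:Z -> 0 < a -> 0 < a * b - f ^+ 2 ->
  a * b * c + 2 * d * e * f - a * d ^+ 2 - b * e ^+ 2 - c * f ^+ 2 = 1 ->
  gram_in_Z3 a b c d e f.
Proof.
elim/ltn_ind: A P a b c d e f => A IHA; elim/ltn_ind => P IHP a b c d e f.
move=> aA abP a0 P0 det1.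
(* Translating [w] by [t * v] changes [a * d - f * e] by [t] times the minor. *)
have [t Ht] := centered_residue (a * d - f * e) P0.
apply: (@gram_in_Z3_translate _ _ _ _ _ _ t).
set c' := c - _ + _; set d' := d - _; set e' := e - _.
have det1' : a * b * c' + 2 * d' * e' * f - a * d' ^+ 2 - b * e' ^+ 2 - c' * f ^+ 2 = 1.
  by rewrite -[RHS]det1 /c' /d' /e'; ring.
have {}Ht : 2 * `|a * d' - f * e'| <= a * b - f ^+ 2.
  suff -> : a * d' - f * e' = a * d - f * e - t * (a * b - f ^+ 2) by [].
  by rewrite /d' /e'; ring.
move: {c d e t det1} c' d' e' det1' Ht => c d e det1 HB.
have adj : (a * b - f ^+ 2) * (a * c - e ^+ 2) - (a * d - f * e) ^+ 2 = a.
  by rewrite -[RHS]mulr1 -[X in _ = _ * X]det1; ring.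
have C0 : 0 < a * c - e ^+ 2.
  rewrite -(pmulr_rgt0 _ P0); move/eqP: adj; rewrite subr_eq => /eqP ->.
  by rewrite ltr_wpDr ?sqr_ge0.
(* If the other minor is smaller, exchanging [v] and [w] allows the inner induction. *)
have [CP|PC] := ltP (a * c - e ^+ 2) (a * b - f ^+ 2).
  apply: gram_in_Z3_swap12; apply: (IHP `|(a * c - e ^+ 2)%R|%N); rewrite ?abszE ?gtr0_norm //.
    by rewrite -ltz_nat abszE gtr0_norm // -abP.
  by rewrite -[RHS]det1; ring.
(* Otherwise [adj] and the bound of a quarter of the squared minor on [(a * d - f * e) ^+ 2]
   apply. *)
have Pa : 3 * (a * b - f ^+ 2) ^+ 2 <= 4 * a.
  move: adj P0 PC HB; set p := a * b - _; set q := a * c - _; set r := a * d - _.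
  move: p q r => p q r adj P0 PC /sqr_le_of_double HB.
  have pq : p * p <= p * q by rewrite ler_pM2l.
  by move: adj pq HB; rewrite !expr2; clear; lia.
have [a1|a1] := eqVneq a 1.
  have P1 : b - f ^+ 2 = 1.
    by move: Pa P0; rewrite a1 mul1r; move: (b - _) => p; rewrite expr2; clear; nia.
  have B0 : d = f * e.
    move: HB; rewrite a1 !mul1r P1 => HB; apply/eqP; rewrite -subr_eq0.
    by move: (d - _) HB => x; clear; lia.
  have C1 : c = e ^+ 2 + 1.
    by move: adj; rewrite a1 !mul1r P1 B0 subrr expr0n subr0 mul1r; clear; lia.
  exists (1, 0, 0), (f, 1, 0), (e, 0, 1); rewrite a1 C1 B0 /=.
  by split; split; rewrite ?mulr0 ?mul0r ?mulr1 ?mul1r ?addr0 //; move: P1; rewrite expr2; clear; lia.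
have [s Hs] := centered_residue f a0.
apply: gram_in_Z3_swap12; apply: gram_in_Z3_swap01.
apply: (@gram_in_Z3_translate _ _ _ _ _ _ s).
apply: gram_in_Z3_swap12; apply: gram_in_Z3_swap01; apply: gram_in_Z3_swap12.
set b' := b - _ + _; set f' := f - _.
have PE : b' * a - f' ^+ 2 = a * b - f ^+ 2 by rewrite /b' /f'; ring.
(* For [a >= 2], [Pa] makes the minor less than [a], and [f'] is at most [a / 2] in absolute value;
   so exchanging [u] and [v] allows the outer induction. *)
have [b0 ba] : 0 < b' /\ b' < a.
  move: PE Pa P0 Hs; set p := a * b - _; rewrite -/f'; move: p f' b' => p f' b'.
  rewrite !expr2 => PE Pa P0 /sqr_le_of_double Hs.
  have a2 : 2 * a <= a * a by rewrite ler_pM2r //; move: a0 a1; clear; lia.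
  have pa : p < a.
    rewrite ltNge; apply/negP => ap; have : a * a <= p * p by apply: ler_pM => //; apply: ltW.
    by move: a0 a2 Pa; clear; lia.
  have ba : b' * a = p + f' * f' by move: PE; clear; lia.
  split; first by rewrite -(pmulr_lgt0 _ a0) ba ltr_wpDr // -expr2 sqr_ge0.
  by rewrite -(ltr_pM2r a0) ba; move: pa a2 Hs a0; clear; lia.
apply: (IHA `|b'|%N _ `|(a * b - f ^+ 2)%R|%N); rewrite ?PE ?abszE ?gtr0_norm //.
  by rewrite -ltz_nat abszE gtr0_norm // -aA.
by rewrite -[RHS]det1 /b' /f'; ring.
Qed.

(** [n] is made the last diagonal entry of a positive Gram matrix of determinant 1, hence the norm
    of a vector of Z^3. *)
Theorem three_squares (n : nat) : (0 < n)%N -> (n %% 4 = 1)%N ->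
  exists x y z : int, x ^+ 2 + y ^+ 2 + z ^+ 2 = n%:Z /\
    ~ [/\ (3 %| x)%Z, (3 %| y)%Z & (3 %| z)%Z].
Proof.
move=> n0 n4; have [k [m [B [m0 /dvdnP[d dE] /dvdnP[C CE]]]]] := residue_modulus n0 n4.
have ndE : k%:Z ^+ 2 * m%:Z = n%:Z * d%:Z - 1 by move: dE; rewrite expr2 -mulnn; clear; lia.
have BE : B%:Z ^+ 2 = C%:Z * m%:Z - n%:Z by move: CE; rewrite expr2 -mulnn; clear; lia.
have d0 : 0 < d%:Z by rewrite ltz_nat; move: dE; case: (d) => //; rewrite mul0n addn1.
(* This [t] gives the minor the value [d], so that the determinant is [n * d - k ^ 2 * m = 1]. *)
pose t : int := d%:Z * (C%:Z * d%:Z - k%:Z ^+ 2).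
have tE : m%:Z * t - (B%:Z * d%:Z) ^+ 2 = d%:Z.
  rewrite exprMn BE /t (_ : _ - _ = d%:Z * (n%:Z * d%:Z - k%:Z ^+ 2 * m%:Z)); last by ring.
  by rewrite ndE; ring.
have det1 : m%:Z * t * n%:Z + 2 * k%:Z * 0 * (B%:Z * d%:Z) - m%:Z * k%:Z ^+ 2 - t * 0 ^+ 2
    - n%:Z * (B%:Z * d%:Z) ^+ 2 = 1.
  rewrite (_ : _ - _ = n%:Z * (m%:Z * t - (B%:Z * d%:Z) ^+ 2) - k%:Z ^+ 2 * m%:Z); last by ring.
  by rewrite tE ndE; ring.
have [||||u [v [[[w1 w2] w3] [[hu hv hw] [hvw huw huv]]]]] :=
  @unimodular_in_Z3 m d m%:Z t n%:Z k 0 (B%:Z * d%:Z) _ _ _ _ det1; rewrite ?tE //.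
exists w1, w2, w3; split; first by rewrite -hw /= !expr2.
(* If 3 divided the third vector, it would divide both [k] and [n], contrary to [ndE]. *)
case=> /dvdzP[y1 y1E] /dvdzP[y2 y2E] /dvdzP[y3 y3E]; move: hvw hw ndE.
rewrite /= y1E y2E y3E => <- <- /(congr1 (fun z => (z %% 3)%Z)).
set X := (_ ^+ 2 * _); set Y := (_ * d%:Z).
have -> : X = 3 * (3 * (v.1.1 * y1 + v.1.2 * y2 + v.2 * y3) ^+ 2 * m%:Z) by rewrite /X; ring.
have -> : Y = 3 * (3 * (y1 * y1 + y2 * y2 + y3 * y3) * d%:Z) by rewrite /Y; ring.
by clear; lia.
Qed.

(** * The quaternary form *)

(* The substitution for a and b makes the last three squared terms of [nineteen_formE]
   congruent modulo 3. *)
Definition nineteen_form (l d i j : int) : int :=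
  let a := 3 * i - d in let b := l + d + 3 * j in
  2 * l ^+ 2 + 3 * l * a + 4 * a ^+ 2 + l * b + b ^+ 2 + d ^+ 2.

Lemma nineteen_formE l d i j :
  let a := 3 * i - d in let b := l + d + 3 * j in
  16 * nineteen_form l d i j =
    19 * l ^+ 2 + (3 * l + 8 * a) ^+ 2 + (2 * l + 4 * b) ^+ 2 + (4 * d) ^+ 2.
Proof. by rewrite /nineteen_form /=; ring. Qed.

Lemma sqr_mod3 (x : int) : exists t, x ^+ 2 = 3 * t /\ (x %% 3)%Z = 0
                         \/ x ^+ 2 = 3 * t + 1 /\ (x %% 3)%Z <> 0.
Proof.
have xE := divz_eq x 3; move: (x %/ 3)%Z xE => k xE.
have [r|[r|r]] : (x %% 3)%Z = 0 \/ (x %% 3)%Z = 1 \/ (x %% 3)%Z = 2 by lia.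
- by exists (3 * k ^+ 2); left; split => //; rewrite xE r; ring.
- by exists (3 * k ^+ 2 + 2 * k); right; split; [rewrite xE r; ring|rewrite r].
- by exists (3 * k ^+ 2 + 4 * k + 1); right; split; [rewrite xE r; ring|rewrite r].
Qed.

Lemma sqr_mod16 (x : int) : exists t,
  [\/ x ^+ 2 = 16 * t /\ (x %% 4)%Z = 0, x ^+ 2 = 16 * t + 4 /\ (x %% 4)%Z = 2,
      x ^+ 2 = 16 * t + 1 /\ ((x %% 8)%Z = 1 \/ (x %% 8)%Z = 7)
    | x ^+ 2 = 16 * t + 9 /\ ((x %% 8)%Z = 3 \/ (x %% 8)%Z = 5)].
Proof.
have xE := divz_eq x 8; have := @modz_ge0 x 8 isT; have := @ltz_pmod x 8 isT.
move: (x %/ 8)%Z xE => k; move Er: (x %% 8)%Z => r xE r0 r8.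
have [q qE] : exists q : int, x ^+ 2 = 16 * q + r ^+ 2.
  by exists (4 * k ^+ 2 + k * r); rewrite xE; ring.
have : r = 0 \/ r = 1 \/ r = 2 \/ r = 3 \/ r = 4 \/ r = 5 \/ r = 6 \/ r = 7 by lia.
case=> [|[|[|[|[|[|[|]]]]]]] rE; rewrite rE in qE xE; rewrite ?rE.
- by exists q; apply: Or41; split; lia.
- by exists q; apply: Or43; split; lia.
- by exists q; apply: Or42; split; lia.
- by exists q; apply: Or44; split; lia.
- by exists (q + 1); apply: Or41; split; lia.
- by exists (q + 1); apply: Or44; split; lia.
- by exists (q + 2); apply: Or42; split; lia.
- by exists (q + 3); apply: Or43; split; lia.
Qed.

(** Squares are 0, 1, 4 or 9 modulo 16, and the only decompositions are 5 = 1 + 4 + 0 and 13 = 9 + 4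
    + 0. [P] carries a property through the permutation. *)
Lemma three_sqr_mod16 (P : int -> Prop) (x y z : int) : P x -> P y -> P z ->
  forall c k : int, x ^+ 2 + y ^+ 2 + z ^+ 2 = 16 * k + c -> c = 5 \/ c = 13 ->
  exists x' y' z' : int, x' ^+ 2 + y' ^+ 2 + z' ^+ 2 = 16 * k + c /\
    [/\ P x', P y', P z', (y' %% 4)%Z = 2 & (z' %% 4)%Z = 0] /\
    (if c == 5 then (x' %% 8)%Z = 1 \/ (x' %% 8)%Z = 7 else (x' %% 8)%Z = 3 \/ (x' %% 8)%Z = 5).
Proof.
move=> Px Py Pz c k sE cE.
have [t1 H1] := sqr_mod16 x; have [t2 H2] := sqr_mod16 y; have [t3 H3] := sqr_mod16 z.
move: sE H1 H2 H3.
have : [/\ y ^+ 2 + x ^+ 2 + z ^+ 2 = x ^+ 2 + y ^+ 2 + z ^+ 2,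
          x ^+ 2 + z ^+ 2 + y ^+ 2 = x ^+ 2 + y ^+ 2 + z ^+ 2,
          y ^+ 2 + z ^+ 2 + x ^+ 2 = x ^+ 2 + y ^+ 2 + z ^+ 2,
          z ^+ 2 + x ^+ 2 + y ^+ 2 = x ^+ 2 + y ^+ 2 + z ^+ 2
        & z ^+ 2 + y ^+ 2 + x ^+ 2 = x ^+ 2 + y ^+ 2 + z ^+ 2] by split; ring.
case=> s1 s2 s3 s4 s5 sE.
have E16 : forall a b d : int, x ^+ 2 = 16 * t1 + a -> y ^+ 2 = 16 * t2 + b -> z ^+ 2 = 16 * t3 + d ->
  ((a + b + d) %% 16)%Z = c.
  by move=> a b d Ha Hb Hd; move: sE; rewrite Ha Hb Hd; case: cE => ->; clear; lia.
rewrite -{1}(addr0 (16 * t1)) -{1}(addr0 (16 * t2)) -{1}(addr0 (16 * t3)).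
case=> [] [/E16 E1 M1]; case=> [] [/E1 {}E1 M2]; case=> [] [/E1 /= E2 M3];
  case: cE => cE; rewrite cE in E2 sE *; try by [];
  first [ by exists x, y, z; rewrite sE | by exists x, z, y; rewrite s2 sE
        | by exists y, x, z; rewrite s1 sE | by exists y, z, x; rewrite s3 sE
        | by exists z, x, y; rewrite s4 sE | by exists z, y, x; rewrite s5 sE ].
Qed.

Lemma nineteen_form_represents (l e : int) : l = 1 \/ l = 3 ->
  (e %% 3)%Z = (l ^+ 2 %% 3)%Z -> 19 * l ^+ 2 < 16 * e ->
  exists d i j : int, nineteen_form l d i j = e /\
     ~ [/\ (3 %| l)%Z, (3 %| d)%Z, (3 %| i)%Z & (3 %| j)%Z].
Proof.
move=> lE el pos.
have l2 : l ^+ 2 = 1 \/ l ^+ 2 = 9 by case: lE => ->; [left|right].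
have [||x [y [z [sE n3]]]] := @three_squares `|(16 * e - 19 * l ^+ 2)%R|%N.
- by lia.
- by case: l2 pos => ->; lia.
have {}sE : x ^+ 2 + y ^+ 2 + z ^+ 2 = 16 * e - 19 * l ^+ 2 by rewrite sE abszE gtr0_norm //; lia.
(* A sum of three squares divisible by 3 has all or none of its terms divisible by 3. *)
have {n3} [x3 y3 z3] : [/\ (x %% 3)%Z <> 0, (y %% 3)%Z <> 0 & (z %% 3)%Z <> 0].
  have [t1 H1] := sqr_mod3 x; have [t2 H2] := sqr_mod3 y; have [t3 H3] := sqr_mod3 z.
  have n3' : (x %% 3)%Z = 0 -> (y %% 3)%Z = 0 -> (z %% 3)%Z = 0 -> False.
    by move=> hx hy hz; apply: n3; split; apply/dvdz_mod0P.
  move: (x ^+ 2) (y ^+ 2) (z ^+ 2) H1 H2 H3 sE => X Y Z H1 H2 H3 sE.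
  case: H1 => [[H1 M1]|[H1 M1]]; case: H2 => [[H2 M2]|[H2 M2]]; case: H3 => [[H3 M3]|[H3 M3]] //;
    first [by case: (n3' M1 M2 M3) | exfalso; move: el sE; case: l2 => ->; lia].
(* -19 is 13 and -171 is 5 modulo 16. *)
have [k [c [kE cE lc]]] : exists k c : int, [/\ 16 * e - 19 * l ^+ 2 = 16 * k + c, c = 5 \/ c = 13 & (c == 13) = (l == 1)].
  by case: lE => ->; [exists (e - 2), 13 | exists (e - 11), 5]; split; rewrite ?expr2; auto; ring.
rewrite kE in sE *.
have [x' [y' [z' [sE' [[x3' y3' z3' y4 z4] xl]]]]] :=
  @three_sqr_mod16 (fun u => (u %% 3)%Z <> 0) x y z x3 y3 z3 c k sE cE.
have {}xl : (x' %% 8)%Z = (3 * l %% 8)%Z \/ (x' %% 8)%Z = (- (3 * l) %% 8)%Z.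
  by move: xl lc; case: cE => ->; case: lE => -> //= xl _; lia.
have [x1 [x1s x1l x1n]] : exists x1 : int,
    [/\ x1 ^+ 2 = x' ^+ 2, (x1 %% 8)%Z = (3 * l %% 8)%Z & (x1 %% 3)%Z <> 0].
  move: x3' xl; clear; move: (3 * l) => m.
  by move=> x3 [] xl; [exists x' | exists (- x'); rewrite sqrrN]; split; by [|lia].
(* Changing the sign of an even number keeps its residue modulo 4, so the sign is free to adjust the
   residue modulo 3. *)
have sgn (u : int) : (u %% 3)%Z <> 0 -> (u %% 2)%Z = 0 -> exists v : int,
    [/\ v ^+ 2 = u ^+ 2, (v %% 3)%Z = (x1 %% 3)%Z & (v %% 4)%Z = (u %% 4)%Z].
  move=> u3 u2; have [ux|ux] := eqVneq (u %% 3)%Z (x1 %% 3)%Z; first by exists u.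
  by exists (- u); rewrite sqrrN; split; [by [] | move: u3 ux x1n; clear; lia | move: u2; clear; lia].
have [|y1 [y1s y1x y1m]] := sgn y' y3'; first by move: y4; clear; lia.
have [|z1 [z1s z1x z1m]] := sgn z' z3'; first by move: z4; clear; lia.
pose a := ((x1 - 3 * l) %/ 8)%Z; pose b := ((y1 - 2 * l) %/ 4)%Z; pose d := (z1 %/ 4)%Z.
have aE : x1 = 3 * l + 8 * a by rewrite /a; move: x1l; clear; lia.
have bE : y1 = 2 * l + 4 * b by rewrite /b y4 in y1m *; case: lE y1m => ->; clear; lia.
have dE : z1 = 4 * d by rewrite /d; move: z1m z4; clear; lia.
(* The congruences between [x1], [y1], [z1] modulo 3 make both divisions exact. *)
pose i := ((a + d) %/ 3)%Z; pose j := ((b - l - d) %/ 3)%Z.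
have iE : a = 3 * i - d.
  by move: z1x; rewrite /i aE dE; move: (a) (d); clear; lia.
have jE : b = l + d + 3 * j.
  move: y1x; rewrite -z1x /j bE dE; move: (b) (d); clear; lia.
exists d, i, j; split.
  have := nineteen_formE l d i j; rewrite /= -iE -jE -aE -bE -dE x1s y1s z1s.
  by rewrite -kE in sE'; move: sE'; clear; lia.
case=> /dvdz_mod0P l3 /dvdz_mod0P d3 _ _; apply: x1n; rewrite -z1x dE; move: d3; move: (d); clear; lia.
Qed.

Lemma sqr_bound (x : int) (k : nat) : x ^+ 2 < (k.+1%:Z) ^+ 2 -> - k%:Z <= x <= k%:Z.
Proof.
rewrite -[x ^+ 2]ger0_norm ?sqr_ge0 // normrX ltr_pXn2r ?nnegrE // => xk.
by rewrite -ler_norml -ltzD1 addrC -intS.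
Qed.

Lemma nineteen_form_values (l d i j : int) : ~ [/\ l = 0, d = 0, i = 0 & j = 0] ->
  4 <= nineteen_form l d i j /\ ((nineteen_form l d i j %% 3)%Z = 0 \/ (nineteen_form l d i j %% 3)%Z = 1).
Proof.
move=> nz; have := nineteen_formE l d i j; cbv zeta.
move Ef: (nineteen_form l d i j) => f; move Ea: (3 * i - d) => a; move Eb: (l + d + 3 * j) => b fE.
have f3 : (f %% 3)%Z = 0 \/ (f %% 3)%Z = 1.
  have [k fk] : exists k : int, f = l ^+ 2 + 3 * k.
    exists (l ^+ 2 + l * j + 3 * l * i + 12 * i ^+ 2 - 8 * i * d + 2 * d ^+ 2 + 2 * l * j + 2 * d * j + 3 * j ^+ 2).
    by rewrite -Ef /nineteen_form; ring.
  have [t] := sqr_mod3 l; rewrite fk; move: (l ^+ 2) => L [[-> _]|[-> _]]; [left|right]; clear; lia.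
split=> //; rewrite leNgt; apply/negP => f4.
have [l0 x0 y0 d0] : [/\ 0 <= l ^+ 2, 0 <= (3 * l + 8 * a) ^+ 2, 0 <= (2 * l + 4 * b) ^+ 2 & 0 <= d ^+ 2].
  by split; apply: sqr_ge0.
have d16 : (4 * d) ^+ 2 = 16 * d ^+ 2 by ring.
(* A value below 4 bounds the sum of the squared terms by 48, leaving finitely many cases. *)
have {fE} [lb xb yb db] : [/\ l ^+ 2 < 4, (3 * l + 8 * a) ^+ 2 < 49, (2 * l + 4 * b) ^+ 2 < 49, d ^+ 2 < 4
    & 16 * f = 19 * l ^+ 2 + (3 * l + 8 * a) ^+ 2 + (2 * l + 4 * b) ^+ 2 + (4 * d) ^+ 2].
  rewrite d16 in fE *; move: l0 x0 y0 d0 fE f4; clear.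
  by move: (l ^+ 2) (d ^+ 2) ((3 * l + 8 * a) ^+ 2) ((2 * l + 4 * b) ^+ 2) => *; split; lia.
have /andP[d1 d2] := @sqr_bound d 1 db; have /andP[l1 l2] := @sqr_bound l 1 lb => fE.
have /andP[a1 a2] := @sqr_bound _ 6 xb; have /andP[b1 b2] := @sqr_bound _ 6 yb.
have dE : [\/ d = -1, d = 0 | d = 1] by have [|[|]] : d = -1 \/ d = 0 \/ d = 1 by [lia]; constructor.
have lE : [\/ l = -1, l = 0 | l = 1] by have [|[|]] : l = -1 \/ l = 0 \/ l = 1 by [lia]; constructor.
have aE : [\/ a = -1, a = 0 | a = 1] by have [|[|]] : a = -1 \/ a = 0 \/ a = 1 by [lia]; constructor.
have bE : b = -2 \/ [\/ b = -1, b = 0 | b = 1] \/ b = 2.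
  have [->|[|]] : b = -2 \/ (-1 <= b <= 1) \/ b = 2 by lia.
  - by left.
  - by move=> bb; right; left; have [|[|]] : b = -1 \/ b = 0 \/ b = 1 by [lia]; constructor.
  by move=> ->; right; right.
move: fE Ea Eb nz f3 f4; clear -dE lE aE bE.
case: dE => ->; case: lE => ->; case: aE => ->; case: bE => [->|[[]->|->]];
  rewrite !expr2 => fE Ea Eb nz f3 f4; try (exfalso; move: fE Ea Eb f3 f4; clear; lia).
by apply: nz; split; [by []|by []| move: Ea; clear; lia| move: Eb; clear; lia].
Qed.

(** * The form on row vectors and its primitive representations *)

Definition hassett_form (v : 'rV[int]_4) : int :=
  2 * nineteen_form (v 0 (inord 0)) (v 0 (inord 1)) (v 0 (inord 2)) (v 0 (inord 3)).

Lemma rV4P (u v : 'rV[int]_4) : u 0 (inord 0) = v 0 (inord 0) -> u 0 (inord 1) = v 0 (inord 1) ->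
  u 0 (inord 2) = v 0 (inord 2) -> u 0 (inord 3) = v 0 (inord 3) -> u = v.
Proof.
move=> h0 h1 h2 h3; apply/rowP => k; rewrite -(inord_val k).
by case: k => [[|[|[|[|m]]]] km].
Qed.

Definition vec4 (l d i j : int) : 'rV[int]_4 := \row_k nth 0 [:: l; d; i; j] k.

Lemma vec4E l d i j : [/\ vec4 l d i j 0 (inord 0) = l, vec4 l d i j 0 (inord 1) = d,
  vec4 l d i j 0 (inord 2) = i & vec4 l d i j 0 (inord 3) = j].
Proof. by split; rewrite mxE inordK. Qed.

Lemma dim_rV4 : dim 'rV[int]_4 = 4%N.
Proof. by []. Qed.

Lemma hassett_form_integral : positive_form hassett_form -> integral_quadratic_form (M := 'rV[int]_4) hassett_form.
Proof.
move=> pos; have hom n v : hassett_form (n *: v) = n ^+ 2 * hassett_form v.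
  by rewrite /hassett_form /nineteen_form !mxE; ring.
have pvv v : polar hassett_form v v = 2 * hassett_form v.
  rewrite /polar -(mulr1n v) -mulrS -scaler_nat hom mulr1n; ring.
split=> //.
  split=> [u|v] k x y; rewrite /polar /hassett_form /nineteen_form !mxE /=; ring.
(* A radical vector has polar value 0 with itself, that is [2 * q v = 0]. *)
split=> [u|v] H; apply/eqP; apply: contraT => /eqP nz.
  by have := pos u nz; have := H u; rewrite pvv; move: (hassett_form u); lia.
by have := pos v nz; have := H v; rewrite pvv; move: (hassett_form v); lia.
Qed.

Lemma hassett_form_vec4 l d i j : hassett_form (vec4 l d i j) = 2 * nineteen_form l d i j.
Proof. by have [hl hd hi hj] := vec4E l d i j; rewrite /hassett_form hl hd hi hj. Qed.

Lemma hassett_form_values v : v <> 0 ->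
  exists2 e : int, hassett_form v = 2 * e & 4 <= e /\ ((e %% 3)%Z = 0 \/ (e %% 3)%Z = 1).
Proof.
move=> nz; eexists; first by [].
apply: nineteen_form_values => -[h0 h1 h2 h3]; apply: nz.
by apply: rV4P; rewrite ?h0 ?h1 ?h2 ?h3 mxE.
Qed.

Lemma hassett_form_positive : positive_form (M := 'rV[int]_4) hassett_form.
Proof. by move=> v /hassett_form_values[e -> [e4 _]]; lia. Qed.

Lemma primitive_of_one (v : 'rV[int]_4) k : v 0 k = 1 -> primitive_vector v.
Proof.
move=> vk; split=> [v0|n w n0 [m E]]; first by move: vk; rewrite v0 mxE.
exists (w 0 k); apply/rowP => h; rewrite mxE.
have /rowP Ew := E; have := Ew h; have := Ew k; rewrite !mxE vk mulr1 => <- Eh.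
by apply: (mulfI (x := n)); [apply/eqP|rewrite Eh mulrA].
Qed.

(** If [w] is rationally a multiple of [v], then [3 * w] is [w 0 k] times [v]; as 3 does not divide
    [v], it divides [w 0 k]. *)
Lemma primitive_of_three (v : 'rV[int]_4) k : v 0 k = 3 ->
  ~ (forall h, (3 %| v 0%R h)%Z) -> primitive_vector v.
Proof.
move=> vk n3; split=> [v0|n w n0 [m E]]; first by move: vk; rewrite v0 mxE.
have /rowP Ew := E; have Ek := Ew k; rewrite !mxE vk in Ek.
have Eh h : 3 * w 0 h = w 0 k * v 0 h.
  have := Ew h; rewrite !mxE => Eh; apply: (mulfI (x := n)); first exact/eqP.
  by rewrite mulrCA Eh [RHS]mulrA Ek; ring.
have /dvdzP[t tE] : (3 %| w 0%R k)%Z.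
  apply: contraT => nd; exfalso; apply: n3 => h.
  have : (3 %| w 0%R k * v 0%R h)%Z by rewrite -Eh dvdz_mulr.
  by rewrite Gauss_dvdzr // coprimezE /= prime_coprime.
exists t; apply/rowP => h; rewrite mxE; apply: (mulfI (x := 3)) => //.
by rewrite Eh tE; ring.
Qed.

Lemma hassett_form_primitive n : hassett n -> exists2 v : 'rV[int]_4, primitive_vector v & hassett_form v = n%:Z.
Proof.
move=> [n6 nm]; pose e := (n %/ 2)%N; have nE : n%:Z = 2 * e%:Z by rewrite /e; lia.
have e4 : (4 <= e)%N by lia.
have [e1|e0] : (e %% 3 = 1)%N \/ (e %% 3 = 0)%N by rewrite /e; lia.
  have [|||d [i [j [fE _]]]] := @nineteen_form_represents 1 e%:Z; [by left|by lia|by lia|].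
  exists (vec4 1 d i j); last by rewrite hassett_form_vec4 fE nE.
  by apply: (@primitive_of_one _ (inord 0)); case: (vec4E 1 d i j).
(* [l = 3] requires [171 < 16 * e]; the smaller multiples of 3, 6 and 9, get explicit vectors. *)
have [e12|e12] := leqP 12 e.
  have [|||d [i [j [fE n3]]]] := @nineteen_form_represents 3 e%:Z; [by right|by lia|by lia|].
  exists (vec4 3 d i j); last by rewrite hassett_form_vec4 fE nE.
  have [hl hd hi hj] := vec4E 3 d i j.
  apply: (@primitive_of_three _ (inord 0)) => // H; apply: n3.
  by split; [exact: dvdzz | rewrite -hd | rewrite -hi | rewrite -hj].
have [E|E] : e = 6%N \/ e = 9%N by lia.
  exists (vec4 0 1 0 0); last by rewrite hassett_form_vec4 nE E.
  by apply: (@primitive_of_one _ (inord 1)); case: (vec4E 0 1 0 0).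
exists (vec4 0 0 0 1); last by rewrite hassett_form_vec4 nE E.
by apply: (@primitive_of_one _ (inord 3)); case: (vec4E 0 0 0 1).
Qed.

Theorem hassett_rank4 : prim_supported_in_rank hassett 4.
Proof.
exists 'rV[int]_4, hassett_form; split.
- exact: dim_rV4.
- exact: hassett_form_integral hassett_form_positive.
- exact: hassett_form_positive.
- move=> n; split=> [[v nz vE]|/hassett_form_primitive[v [nz _] vE]]; last by exists v.
  have [e eE [e4 em]] := hassett_form_values nz; move: eE; rewrite vE => eE.
  by split; [lia|case: em => em; [left|right]; lia].
- exact: hassett_form_primitive.
Qed.

(** * The lower bound *)

Import TernaryObstruction VectorInternalTheory.

Definition zero_or_hassett (m : int) : Prop := m = 0 \/ exists2 k, hassett k & m = k%:Z.

Lemma allowedP (m : int) : zero_or_hassett m -> allowed (Z_of_int m) = true.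
Proof.
case=> [->//|[k [k6 km] ->]]; apply/allowed_spec; right; split; first by lia.
by exists (Z.of_nat (k %/ 6)); lia.
Qed.

Lemma allowed_hassett (m : Z) : (Z.lt 0 m) -> allowed m = true -> exists2 k, hassett k & m = Z_of_int k%:Z.
Proof.
move=> m0 /allowed_spec[|[m6 [k mE]]]; first by lia.
by exists (Z.to_nat m); [split; lia|lia].
Qed.

Definition ternary_int (n b c d x y z : int) : int :=
  8 * x ^+ 2 + 12 * y ^+ 2 + n * z ^+ 2 + b * (x * y) + c * (x * z) + d * (y * z).

Lemma ternary_intE n b c d x y z : Z_of_int (ternary_int n b c d x y z) =
  ternary (Z_of_int n) (Z_of_int b) (Z_of_int c) (Z_of_int d) (Z_of_int x) (Z_of_int y) (Z_of_int z).
Proof. rewrite /ternary_int /ternary; lia. Qed.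

Lemma ternary_int_obstruction (b : int) :
  (forall x y, zero_or_hassett (ternary_int 0 b 0 0 x y 0)) ->
  exists2 n, hassett n & forall c d,
    (forall x y z, zero_or_hassett (ternary_int n%:Z b c d x y z)) ->
    exists2 e, hassett e & forall x y z t : int,
      ternary_int n%:Z b c d x y z = e%:Z * t ^+ 2 -> [/\ x = 0, y = 0, z = 0 & t = 0].
Proof.
move=> H2; have [|n [nE Hn]] := @ternary_obstruction (Z_of_int b).
  move=> x y; rewrite -(int_of_ZK x) -(int_of_ZK y).
  by have := allowedP (H2 (int_of_Z x) (int_of_Z y)); rewrite ternary_intE.
have [k hk kE] : exists2 k, hassett k & n = Z_of_int k%:Z.
  by case: nE => ->; [exists 14%N | exists 18%N] => //; split => //; [right|left].
exists k => // c d H3; have [|e [[e0 ea] He]] := Hn (Z_of_int c) (Z_of_int d).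
  move=> x y z; rewrite -(int_of_ZK x) -(int_of_ZK y) -(int_of_ZK z).
  by have := allowedP (H3 (int_of_Z x) (int_of_Z y) (int_of_Z z)); rewrite ternary_intE -kE.
have [m hm mE] := allowed_hassett e0 ea; exists m => // x y z t E.
have [|x0 [y0 [z0 t0]]] := He (Z_of_int x) (Z_of_int y) (Z_of_int z) (Z_of_int t).
  by rewrite kE mE -ternary_intE E; lia.
by split; lia.
Qed.

(** The coordinate matrix has a nonzero rational left kernel vector, whose denominators are cleared
    by their product. *)
Lemma int_linear_relation (M : vectType int) (v : 'I_4 -> M) : (dim M < 4)%N ->
  exists2 c : 'I_4 -> int, \sum_i c i *: v i = 0 & exists i, c i != 0.
Proof.
move=> dM; pose A : 'M[rat]_(4, dim M) := \matrix_(i, j) (v2r (v i) 0 j)%:~R.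
pose u := nz_row (kermx A).
have u0 : u != 0.
  rewrite nz_row_eq0 kermx_eq0 /row_free; apply: contraTneq dM => rA.
  by rewrite -leqNgt -{1}rA rank_leq_col.
have uA : u *m A = 0 by apply/sub_kermxP; apply: nz_row_sub.
pose D i := \prod_(j | j != i) denq (u 0 j).
have cE i : (numq (u 0 i) * D i)%:~R = u 0 i * (\prod_j denq (u 0 j))%:~R.
  by rewrite (bigD1 i) //= !intrM numqE mulrA.
exists (fun i => numq (u 0 i) * D i); last first.
  have /rV0Pn[i ui] := u0; exists i; rewrite mulf_neq0 ?numq_eq0 //.
  by apply/prodf_neq0 => j _; apply: denq_neq0.
apply: (can_inj v2rK); rewrite linear0 linear_sum; apply/rowP => j.
rewrite summxE mxE; apply: (@intr_inj rat); rewrite rmorph_sum /=.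
have /rowP/(_ j) := uA; rewrite !mxE => Ej.
rewrite mulr0z -[RHS](mul0r (\prod_j denq (u 0 j))%:~R) -[X in _ = X * _]Ej mulr_suml.
by apply: eq_bigr => i _; rewrite linearZ !mxE intrM cE mulrAC.
Qed.

Section LowerBound.
Variables (M : vectType int) (q : M -> int).
Hypotheses (qI : integral_quadratic_form q) (qpos : positive_form q).
Hypothesis qim : forall n : nat, im q n <-> hassett n.

Let B := polar q.

Let qZ n v : q (n *: v) = n ^+ 2 * q v. Proof. by case: qI => H _ _; apply: H. Qed.

Let qD u v : q (u + v) = q u + q v + B u v. Proof. by rewrite /B /polar; ring. Qed.

Let BDr u a v w : B u (a *: v + w) = a * B u v + B u w.
Proof. by case: qI => _ [H _] _; apply: H. Qed.

Let BDl u a v w : B (a *: v + w) u = a * B v u + B w u.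
Proof. by case: qI => _ [_ H] _; apply: H. Qed.

Let B0r u : B u 0 = 0.
Proof. by have := BDr u 1 0 0; rewrite scaler0 addr0 mul1r; move: (B u 0) => b; lia. Qed.

Let B0l u : B 0 u = 0.
Proof. by have := BDl u 1 0 0; rewrite scaler0 addr0 mul1r; move: (B 0 u) => b; lia. Qed.

Let BZr u a v : B u (a *: v) = a * B u v.
Proof. by have := BDr u a v 0; rewrite !addr0 B0r addr0. Qed.

Let BZl u a v : B (a *: v) u = a * B v u.
Proof. by have := BDl u a v 0; rewrite !addr0 B0l addr0. Qed.

Let q_comb u v w x y z : q (x *: u + y *: v + z *: w) =
  x ^+ 2 * q u + y ^+ 2 * q v + z ^+ 2 * q w + x * y * B u v + x * z * B u w + y * z * B v w.
Proof. by rewrite !qD !qZ BDl !BZl !BZr; ring. Qed.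

Let q_value v : zero_or_hassett (q v).
Proof.
have [->|/eqP v0] := eqVneq v 0.
  by left; have := qZ 0 (0 : M); rewrite scale0r expr0n mul0r.
right; have qv := qpos v0; exists `|q v|%N; last by rewrite abszE gtr0_norm.
by apply/qim; exists v; rewrite // abszE gtr0_norm.
Qed.

Let q_attains n : hassett n -> exists v, q v = n%:Z.
Proof. by move/qim => [v _ vE]; exists v. Qed.

(** In smaller rank, vectors of values 8, 12, [n] and [e] satisfy an integral relation; applying [q]
    to it gives a zero of the anisotropic form, so all its coefficients vanish. *)
Lemma hassett_rank_ge4 : (4 <= dim M)%N.
Proof.
rewrite leqNgt; apply/negP => dM.
have [|v1 v1E] := @q_attains 8; first by split=> //; right.
have [|v2 v2E] := @q_attains 12; first by split=> //; left.
have [|n hn Hn] := @ternary_int_obstruction (B v1 v2).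
  move=> x y; have := q_value (x *: v1 + y *: v2 + 0 *: 0).
  rewrite q_comb v1E v2E; congr zero_or_hassett; rewrite /ternary_int; ring.
have [v3 v3E] := q_attains hn.
have QE x y z : q (x *: v1 + y *: v2 + z *: v3) =
    ternary_int n%:Z (B v1 v2) (B v1 v3) (B v2 v3) x y z.
  by rewrite q_comb v1E v2E v3E /ternary_int; ring.
have [|e he He] := Hn (B v1 v3) (B v2 v3); first by move=> x y z; rewrite -QE.
have [v4 v4E] := q_attains he.
have [c] := @int_linear_relation M (fun i => nth 0 [:: v1; v2; v3; v4] i) dM.
rewrite !big_ord_recl big_ord0 addr0 /= => cE [i]; apply/negP; rewrite negbK.
set c0 := c ord0 in cE; set c1 := c (lift ord0 ord0) in cE.
set c2 := c (lift ord0 (lift ord0 ord0)) in cE.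
set c3 := c (lift ord0 (lift ord0 (lift ord0 ord0))) in cE.
have E : c0 *: v1 + c1 *: v2 + c2 *: v3 = (- c3) *: v4.
  by apply/eqP; rewrite scaleNr -subr_eq0 opprK -!addrA cE.
have [x0 y0 z0 t0] : [/\ c0 = 0, c1 = 0, c2 = 0 & c3 = 0].
  by apply: He; rewrite -QE E qZ v4E sqrrN mulrC.
apply/eqP; case: i => [[|[|[|[|//]]]] i4].
- by rewrite -x0; congr c; apply: val_inj.
- by rewrite -y0; congr c; apply: val_inj.
- by rewrite -z0; congr c; apply: val_inj.
- by rewrite -t0; congr c; apply: val_inj.
Qed.
End LowerBound.

Local Close Scope ring_scope.

Theorem theorem1p2 : is_r_prim hassett 4.
Proof.
split; first exact: hassett_rank4.
by move=> r [M [q [<- qI qpos qim _]]]; apply: hassett_rank_ge4 qI qpos qim.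
Qed.
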